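(* Let $h^{(N)}>0$, $b^{(N)}>0$ be sequences and let $\gamma_N=\frac{Nh^{(N)}}{Nh^{(N)}+b^{(N)}}$. Let $(I_N^*,\beta_N^* )$ be the minimizer of the cost function $F_N$ and let $(\hat I_N,\hat\beta_N)$ be the minimizer of the approximate cost function $\hat F_N$ (both defined in the context). Then, as $N\to\infty$: (i) (balanced regime) if $\gamma_N=\gamma\in(0,1)$ for all $N$, then $$\frac{F_N(I_N^*,\beta_N^* )}{F_N(\hat I_N,\hat\beta_N)}=1-O\left(\frac{1}{N\log N}\right);$$ (ii) (quality driven regime) if $\gamma_N\to 0$, then $$\frac{F_N(I_N^*,\beta_N^* )}{F_N(\hat I_N,\hat\beta_N)}=1-O\left(\frac{\gamma_N}{N\log(N/\gamma_N)}\right);$$ (iii) (efficiency driven regime) if $\gamma_N\to 1$ and $\gamma_N<1-\exp(-N)$ for all $N$, then $$\frac{F_N(I_N^*,\beta_N^* )}{F_N(\hat I_N,\hat\beta_N)}=1-O\left(\frac{1}{\log N}\right).$$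
   Context: Fix $\sigma>0$. Let $W_1,W_2,\dots$ be independent Brownian motions started at $0$ with mean $0$ and variance $\sigma^2$ (i.e. $\mathrm{Var}(W_i(t))=\sigma^2t$), and let $Q_i=\sup_{s>0}(W_i(s)-s)$. For $N\ge 2$ (it suffices to consider large $N$), $I\in\mathbb R$ and $\beta>0$ define, with $x^+=\max(x,0)$, $$C_N(I)=\mathbb E\Big[Nh^{(N)}(I-Q_i)+(Nh^{(N)}+b^{(N)})\big(\max_{j\le N}Q_j-I\big)^+\Big],\qquad F_N(I,\beta)=\frac1\beta C_N(I)+\beta N,$$ (the $Q_i$ are identically distributed, so the choice of $i$ is irrelevant) and $$\hat C_N(I)=\mathbb E\Big[Nh^{(N)}(I-Q_i)+(Nh^{(N)}+b^{(N)})\big(\tfrac{\sigma^2}{2}G+\tfrac{\sigma^2}{2}\log N-I\big)^+\Big],\qquad \hat F_N(I,\beta)=\frac1\beta\hat C_N(I)+\beta N,$$ where $G$ has the standard Gumbel distribution $\mathbb P(G\le x)=e^{-e^{-x}}$. $(I_N^*,\beta_N^* )$ denotes the minimizer of $F_N$ and $(\hat I_N,\hat\beta_N)$ the minimizer of $\hat F_N$ over $I\in\mathbb R$, $\beta>0$. *)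

(* Defs.v *)
From HB Require Import structures.
From mathcomp Require Import all_boot all_order all_algebra finmap.
From mathcomp Require Import all_classical all_reals all_analysis.

Set Implicit Arguments.
Unset Strict Implicit.
Unset Printing Implicit Defensive.

Import Order.TTheory GRing.Theory Num.Theory.
Import numFieldNormedType.Exports.

Local Open Scope classical_set_scope.
Local Open Scope ring_scope.

Section Independence.
Context (d : measure_display) (T : measurableType d) (R : realType)
        (P : probability T R).

Definition independent_classes (I : choiceType) (F : I -> set (set T)) : Prop :=
  forall (J : {fset I}) (E : I -> set T),
    (forall i, i \in J -> F i (E i)) ->
    P (\bigcap_(i in [set` J]) E i) = (\prod_(i <- J) P (E i))%E.

(* The sigma-algebra generated by the family (X t), t \in D. *)
Definition sigma_of (A : Type) (D : set A) (X : A -> T -> R) : set (set T) :=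
  <<s \bigcup_(t in D) preimage_set_system setT (X t) measurable >>.

Definition independent_variables (I : choiceType) (X : I -> T -> R) : Prop :=
  independent_classes (fun i => preimage_set_system setT (X i) measurable).

(* Only the times t >= 0 of the processes matter. *)
Definition independent_processes (I : choiceType) (W : I -> R -> T -> R)
    : Prop :=
  independent_classes (fun i => sigma_of [set t | 0 <= t] (W i)).

End Independence.

Section BrownianMotion.
Context (d : measure_display) (T : measurableType d) (R : realType)
        (P : probability T R).

(* Driftless Brownian motion started at 0 with Var (W t) = sigma^2 t. Processes
   are indexed by all of R, but only the times t >= 0 are constrained. The
   second parameter of [normal_prob] is the standard deviation. Finitely many
   times extend to an infinite nondecreasing sequence of times, so the third
   clause is the usual independence of increments. *)
Definition brownian_motion (sigma : R) (W : R -> {RV P >-> R}) : Prop :=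
  [/\ {ae P, forall w, W 0 w = 0},
      forall s t : R, 0 <= s -> s < t ->
        forall A : set R, measurable A ->
          P [set w | A (W t w - W s w)] =
          normal_prob 0 (sigma * Num.sqrt (t - s)) A,
      forall t : nat -> R, 0 <= t 0%N -> {homo t : m n / (m <= n)%N >-> m <= n} ->
        independent_variables P (fun k : nat => W (t k.+1) \- W (t k))
    & forall w, {within [set t : R | 0 <= t], continuous (fun t => W t w)}].

(* The real supremum [sup] is 0 on the sets that are not bounded above; here
   this only happens with probability 0. *)
Definition sup_drifted (W : R -> T -> R) (w : T) : R :=
  sup [set W s w - s | s in [set s : R | 0 < s]].

Definition standard_gumbel (G : {RV P >-> R}) : Prop :=
  forall x : R, cdf G x = (expR (- expR (- x)))%:E.

End BrownianMotion.

Section Costs.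
Context (d : measure_display) (T : measurableType d) (R : realType)
        (P : probability T R).
Variables (sigma : R) (W : nat -> R -> T -> R) (G : T -> R) (h b : nat -> R).

Let Q (i : nat) : T -> R := sup_drifted (W i).

(* The processes are numbered from 0, so the first N are the W j with j < N.
   The Q i are identically distributed; i = 0 is used in the costs. *)

(* max_(j < N) Q j, for N >= 1: the default value Q 0 is one of the Q j. *)
Definition max_sup (N : nat) (w : T) : R :=
  \big[Num.max/Q 0 w]_(j < N) Q j w.

Definition cost (N : nat) (I : R) : \bar R :=
  'E_P[fun w => N%:R * h N * (I - Q 0 w)
                + (N%:R * h N + b N) * Num.max (max_sup N w - I) 0].

Definition approx_cost (N : nat) (I : R) : \bar R :=
  'E_P[fun w => N%:R * h N * (I - Q 0 w)
                + (N%:R * h N + b N) *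
                  Num.max (sigma ^+ 2 / 2 * G w
                           + sigma ^+ 2 / 2 * ln N%:R - I) 0].

Definition total_cost (C : nat -> R -> \bar R) (N : nat) (I beta : R) : \bar R :=
  ((beta^-1)%:E * C N I + (beta * N%:R)%:E)%E.

Definition F_cost : nat -> R -> R -> \bar R := total_cost cost.
Definition F_approx : nat -> R -> R -> \bar R := total_cost approx_cost.

Definition gamma_ratio (N : nat) : R := N%:R * h N / (N%:R * h N + b N).

End Costs.

Definition is_minimizer (R : realType) (F : R -> R -> \bar R) (x : R * R)
    : Prop :=
  0 < x.2 /\ forall I beta : R, 0 < beta -> (F x.1 x.2 <= F I beta)%E.

(* The values of F at the points of interest are finite. *)
Definition cost_ratio (R : realType) (F : nat -> R -> R -> \bar R)
    (x y : nat -> R * R) (N : nat) : R :=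
  fine (F N (x N).1 (x N).2) / fine (F N (y N).1 (y N).2).

(* Main.v *)
(** Since [1 - u <= exp (- u)], the maximum of the [N] independent suprema is
    stochastically larger than its Gumbel approximation, so the approximate
    cost is a lower bound of the cost. For a fixed base-stock level [x] the
    optimal [beta] is explicit and the optimal value is a multiple of
    [sqrt (cost N x)], so the relative gap is at most
    [(cost N x - approx_cost N x) / approx_cost N x] at the level [x] that is
    optimal for the approximate cost, where the tail of the approximation
    equals [gamma]. The numerator is the integral of the difference of the two
    tails, which at height [y] is at most [N u^2 exp (- (N - 1) u)] with
    [u = exp (- 2 y / sigma^2)].

    This uses that the suprema are exponentially distributed, which is Doob's
    argument for [exp (2 (W s - s) / sigma^2)] run along the grid of mesh
    [1 / m^2] up to time [m]: overshoots and the mass still below the level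
    vanish as [m] grows. *)

Require Import Defs.
From HB Require Import structures.
From mathcomp Require Import all_boot all_order all_algebra finmap.
From mathcomp Require Import all_classical all_reals all_analysis.
From mathcomp Require Import measurable_realfun ring lra.

Set Implicit Arguments.
Unset Strict Implicit.
Unset Printing Implicit Defensive.

Import Order.TTheory GRing.Theory Num.Theory.
Import numFieldNormedType.Exports.

Local Open Scope classical_set_scope.
Local Open Scope ring_scope.

(** * Exponential moments of the normal law *)

(** Write [th = 2 / sigma ^+ 2] and [kappa = - ln (1 - gamma)]. The optimal approximate level [q]
    satisfies [N * expR (- (th * q)) = kappa], so everything depends on the size of [kappa] relative
    to [N]. Dropping the exponential factor from the tail bound leaves an absolute gap of order
    [kappa^2 / N]. While [kappa] stays bounded, the linear part [gamma * (q - E Q)] of the cost, of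
    order [gamma * ln (N / kappa)], is a large enough denominator. When [gamma] tends to 1, [kappa]
    may grow up to [N]: then [kappa^2 / N] is useless and [q] may be close to 0. There the factor
    [N u exp (- (N - 1) u)] is bounded instead, which gives a gap of order 1, and the mean excess
    supplies what the linear part loses, since the Gumbel tail is at least [1 - exp (-1)] up to the
    level [ln N / th]. The assumption [gamma < 1 - exp (- N)] says [kappa < N], that is [q > 0];
    below 0 the tail of the maximum no longer follows the exponential formula. The mean of the
    suprema enters both costs through the same term, so only its finiteness matters. *)

Section normal_mgf.
Context {R : realType}.
Local Notation mu := (@lebesgue_measure R).

(** Two densities with the same integral over every measurable set agree almost everywhere, so the
    Radon-Nikodym derivative may be replaced by the Gaussian density. *)
Lemma integral_normal_prob (m s : R) (f : R -> \bar R) :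
  measurable_fun [set: R] f -> (forall x, 0 <= f x)%E ->
  (\int[normal_prob m s]_x f x = \int[mu]_x (f x * (normal_pdf m s x)%:E))%E.
Proof.
move=> mf f0.
have dom : normal_prob m s `<< mu by exact: normal_prob_dominates.
rewrite -(Radon_Nikodym_SigmaFinite.change_of_variables dom)//=.
have mp : measurable_fun [set: R] (fun x => (normal_pdf m s x)%:E).
  by apply/measurable_EFinP; exact: measurable_normal_pdf.
have ir := Radon_Nikodym_SigmaFinite.f_integrable dom.
have mr := measurable_int _ ir.
apply: ae_eq_integral => //.
- exact: emeasurable_funM.
- exact: emeasurable_funM.
- apply: ae_eqe_mul2l => /=.
  apply: integral_ae_eq => //= E _ mE.
  by rewrite -Radon_Nikodym_SigmaFinite.f_integral.
Qed.

(** Completing the square: tilting the centred density by [expR (a * x)] gives, up to the constant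
    on the right, the density with mean [a * s ^+ 2]. *)
Lemma normal_mgf (s a : R) : s != 0 ->
  (\int[normal_prob 0 s]_x (expR (a * x))%:E = (expR (a ^+ 2 * s ^+ 2 /
    2))%:E)%E.
Proof.
move=> s0.
have mexp : measurable_fun [set: R] (fun x => (expR (a * x))%:E).
  by apply/measurable_EFinP; apply: measurableT_comp.
rewrite integral_normal_prob//.
transitivity (\int[mu]_x ((expR (a ^+ 2 * s ^+ 2 / 2))%:E *
   (normal_pdf (a * s ^+ 2) s x)%:E))%E.
  apply: eq_integral => x _; rewrite -!EFinM !normal_pdfE//; congr EFin.
  rewrite /normal_fun !(mulrCA _ (normal_peak s)) -!expRD.
  congr (_ * expR _); field.
  by [].
rewrite integralZl//; last exact: integrable_normal_pdf.
by rewrite integral_normal_pdf mule1.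
Qed.

End normal_mgf.

(** * Independence from the past *)

Section fset_iota.
Context {R : realType}.

Lemma set_fset_iota (m : nat) : [set` [fset j in iota 0 m]%fset] = `I_m.
Proof. by apply/seteqP; split => j /=; rewrite !inE/= mem_iota add0n. Qed.

Lemma prod_fset_iota (m : nat) (F : nat -> \bar R) :
  (\prod_(j <- [fset j in iota 0 m]%fset) F j = \prod_(j < m) F j)%E.
Proof.
rewrite -[RHS](big_mkord xpredT F).
apply: perm_big; apply: uniq_perm; [exact: fset_uniq|exact: iota_uniq|].
by move=> j; rewrite !inE/= mem_index_iota mem_iota.
Qed.

End fset_iota.

Section independence.
Context d (T : measurableType d) (R : realType) (P : probability T R).
Local Open Scope ereal_scope.

Lemma expectation_mul_indep (X Y : T -> R) :
  measurable_fun setT X -> measurable_fun setT Y ->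
  (forall w, 0 <= X w)%R -> (forall w, 0 <= Y w)%R ->
  (forall A B, measurable A -> measurable B ->
     P (X @^-1` A `&` Y @^-1` B) = P (X @^-1` A) * P (Y @^-1` B)) ->
  \int[P]_w (X w * Y w)%:E = (\int[P]_w (X w)%:E) * (\int[P]_w (Y w)%:E).
Proof.
move=> mX mY X0 Y0 indep.
have mZ : measurable_fun setT (fun w => (X w, Y w)) by exact:
  measurable_fun_pair.
pose X' : {RV P >-> R} := mfun_Sub (mem_set mX).
pose Y' : {RV P >-> R} := mfun_Sub (mem_set mY).
pose Z' : {RV P >-> (R * R)%type} := mfun_Sub (mem_set mZ).
(* The absolute values make the integrand nonnegative on the whole plane, as Tonelli requires; they
   vanish on the values of [X] and [Y]. *)
pose f (z : R * R) := (`|z.1| * `|z.2|)%:E.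
have mf : measurable_fun setT f.
  apply/measurable_EFinP; apply: measurable_funM.
    by apply: measurableT_comp => //; exact: measurable_fst.
  by apply: measurableT_comp => //; exact: measurable_snd.
have mabs : measurable_fun [set: R] (fun y : R => `|y|%:E).
  by apply/measurable_EFinP; exact: normr_measurable.
have f0 z : 0 <= f z by rewrite lee_fin mulr_ge0.
transitivity (\int[distribution P Z']_z f z).
  rewrite ge0_integral_distribution//; apply: eq_integral => w _ /=.
  by rewrite /f /= !ger0_norm.
transitivity (\int[distribution P X' \x distribution P Y']_z f z).
  apply: eq_measure_integral => A mA _; apply/esym.
  exact: product_measure_unique.
rewrite fubini_tonelli1// /fubini_F /f /=.
transitivity (\int[distribution P X']_x (`|x|%:E * \int[distribution P Y']_y
  `|y|%:E)).
  apply: eq_integral => x _; under eq_integral do rewrite EFinM.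
  by rewrite ge0_integralZl.
rewrite ge0_integralZr//; last exact: integral_ge0.
rewrite !ge0_integral_distribution//=.
by congr (_ * _); apply: eq_integral => w _; rewrite /= ger0_norm.
Qed.


(* Generates the sigma-algebra of the first [n] variables. *)
Definition past (xi : nat -> T -> R) (n : nat) : set (set T) :=
  \bigcup_(j in `I_n) preimage_set_system setT (xi j) measurable.

(** Both sides are finite measures in [A]. They agree on the cylinders over the first [n]
    coordinates, which are stable under intersection and generate the past, so they agree on the
    past. *)
Lemma independent_past (xi : nat -> {RV P >-> R}) (n : nat) (A : set T)
    (B : set R) :
  independent_variables P (fun k => xi k : T -> R) -> measurable B ->
  <<s past (fun k => xi k : T -> R) n >> A ->
  P (A `&` xi n @^-1` B) = P A * P (xi n @^-1` B).
Proof.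
move=> indep mB pA.
have mxi j C : measurable C -> measurable (xi j @^-1` C).
  by move=> mC; rewrite -[X in measurable X]setTI; exact: measurable_funP.
pose cyl (E : nat -> set R) := \bigcap_(j in `I_n) xi j @^-1` E j.
pose G := [set S | exists2 E : nat -> set R,
  (forall j, measurable (E j)) & S = cyl E].
have mcyl E : (forall j, measurable (E j)) -> measurable (cyl E).
  move=> mE; rewrite /cyl; apply: bigcap_measurableType => j _.
  exact: mxi.
have Gm : G `<=` measurable by move=> _ [E mE ->]; exact: mcyl.
have GI : setI_closed G.
  move=> _ _ [E mE ->] [F mF ->]; exists (fun j => E j `&` F j).
    by move=> j; exact: measurableI.
  by rewrite /cyl -bigcapI.
have GT : G setT.
  exists (fun=> setT) => //; by rewrite /cyl; apply/seteqP; split => // w _ j _.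
have Pcyl m E : (forall j, measurable (E j)) ->
    P (\bigcap_(j in `I_m) xi j @^-1` E j) = \prod_(j < m) P (xi j @^-1` E j).
  move=> mE; rewrite -set_fset_iota (indep _ (fun j => xi j @^-1` E j)).
    exact: prod_fset_iota.
  by move=> j _; exists (E j); rewrite ?setTI.
pose m1 := mrestr P (mxi n B mB).
have m1E S : m1 S = P (S `&` xi n @^-1` B) by [].
have [c PB] : exists c : {nonneg R}, P (xi n @^-1` B) = c%:num%:E.
  have PB0 : (0 <= fine (P (xi n @^-1` B)))%R by rewrite fine_ge0.
  by exists (NngNum PB0); rewrite /= fineK// fin_num_measure//;
    exact: (mxi n B).
pose m2 := mscale c P.
have m2E S : m2 S = P S * P (xi n @^-1` B) by rewrite muleC PB.
have pG : <<s past (fun k => xi k : T -> R) n >> `<=` <<s G >>.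
  apply: smallest_sub; first exact: smallest_sigma_algebra.
  move=> _ [j jn [C mC <-]]; apply: sub_sigma_algebra.
  exists (fun i => if i == j then C else setT).
    by move=> i; case: ifP.
  rewrite setTI; apply/seteqP; split => [w Cw i _ /=|w /(_ j jn)/=].
    by case: eqP => // ->.
  by rewrite eqxx.
rewrite -m1E -m2E.
apply: (@g_sigma_algebra_measure_unique _ R T G Gm (fun=> setT)) => //.
- by rewrite bigcup_const.
- move=> _ [E mE ->]; rewrite -[LHS]/(m1 _) -[RHS]/(m2 _) m1E m2E.
  (* With [B] as coordinate [n], the intersection becomes a cylinder over [n.+1] coordinates. *)
  pose E' j := if j == n then B else E j.
  have mE' j : measurable (E' j) by rewrite /E'; case: ifP.
  have -> : cyl E `&` xi n @^-1` B = \bigcap_(j in `I_n.+1) xi j @^-1` E' j.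
    apply/seteqP; split => [w [Ew Bw] j /=|w Ew].
      rewrite /E'; case: eqP => [->//|/eqP jn].
      by rewrite ltnS leq_eqVlt (negbTE jn) => /Ew.
    split; last by have := Ew n (ltnSn n); rewrite /= /E' eqxx.
    move=> j /= jn; have := Ew j (ltnW jn).
    by rewrite /= /E' (ltn_eqF jn).
  rewrite Pcyl// big_ord_recr/= /E' eqxx /cyl Pcyl//; congr (_ * _).
  by apply: eq_bigr => j _; rewrite (ltn_eqF (ltn_ord j)).
- by move=> _; rewrite -[ltLHS]/(m1 _) m1E setTI (le_lt_trans (probability_le1
    _ _)) ?ltry//; exact: (mxi n B).
- exact: pG.
Qed.

End independence.

(** * Level crossing by a random walk *)

Section walk.
Context d (T : measurableType d) (R : realType) (P : probability T R).
Variables (xi : nat -> {RV P >-> R}) (th x : R).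
Hypothesis indep : independent_variables P (fun k => xi k : T -> R).
Hypothesis x_ge0 : 0 <= x.
Hypothesis mgf1 : forall k, (\int[P]_w (expR (th * xi k w))%:E = 1)%E.

Definition walk (n : nat) (w : T) : R := \sum_(k < n) xi k w.

Definition walk_below (n : nat) : set T :=
  [set w | forall k, (k <= n)%N -> walk k w <= x].

Lemma walkS n w : walk n.+1 w = walk n w + xi n w.
Proof. by rewrite /walk big_ord_recr. Qed.

Lemma walk_below0 : walk_below 0 = setT.
Proof.
apply/seteqP; split => // w _ k; rewrite leqn0 => /eqP ->.
by rewrite /walk big_ord0.
Qed.

Lemma walk_belowS n :
  walk_below n.+1 = walk_below n `&` [set w | walk n.+1 w <= x].
Proof.
apply/seteqP; split => [w wn|w [wn wx] k].
  by split; [move=> k kn; exact/wn/leqW|exact: wn].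
by rewrite leq_eqVlt => /orP[/eqP ->//|]; exact: wn.
Qed.

(** A copy of [T] with the sigma-algebra of the first [n] increments, so that being determined by
    the past is ordinary measurability. *)
Local Notation T_past n :=
  (g_sigma_algebraType (past (fun k => xi k : T -> R) n)).

Lemma past_walk n k : (k <= n)%N ->
  measurable_fun setT (walk k : T_past n -> R).
Proof.
move=> kn; apply: measurable_sum => j _ A mA.
apply: sub_sigma_algebra; exists j; first exact: leq_trans kn.
by exists A.
Qed.

Lemma past_walk_below n : @measurable _ (T_past n) (walk_below n).
Proof.
have -> : walk_below n = \bigcap_(k in `I_n.+1) [set w | walk k w <= x].
  by apply/seteqP; split => w h k; [exact: (h k)|move=> kn; exact: (h k)].
apply: (@bigcap_measurableType _ (T_past n)) => k kn.
have {}kn : (k <= n)%N by [].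
have -> : [set w | walk k w <= x] = walk k @^-1` `]-oo, x].
  by apply/seteqP; split => w /=; rewrite in_itv.
by have := past_walk kn measurableT (measurable_itv `]-oo, x]); rewrite setTI.
Qed.

Lemma past_measurable n (A : set T) : @measurable _ (T_past n) A -> measurable
    A.
Proof.
apply: smallest_sub; first exact: sigma_algebra_measurable.
move=> _ [j _ [B mB <-]]; rewrite setTI -[X in measurable X]setTI.
exact: measurable_funP.
Qed.

Lemma measurable_walk n : measurable_fun setT (walk n).
Proof. by apply: measurable_sum => j; exact: measurable_funP. Qed.

Lemma measurable_walk_below n : measurable (walk_below n).
Proof. by apply: (@past_measurable n); apply: past_walk_below. Qed.

(** The share of the exponential martingale carried by the paths that have not crossed by step
    [n]. *)
Definition stopped_mass (n : nat) : \bar R :=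
  (\int[P]_w (expR (th * walk n w) * \1_(walk_below n) w)%:E)%E.

(** The martingale step: survival up to [n] is determined by the past, so the next factor is
    independent of the rest and has mean 1. *)
Lemma stopped_massS n :
  (\int[P]_w (expR (th * walk n.+1 w) * \1_(walk_below n) w)%:E =
   stopped_mass n)%E.
Proof.
pose X w := expR (th * walk n w) * \1_(walk_below n) w.
pose Y w := expR (th * xi n w).
have mX : measurable_fun setT (X : T_past n -> R).
  apply: measurable_funM; last by apply: measurable_indic;
    apply: past_walk_below.
  apply: measurableT_comp => //; apply: measurable_funM => //.
  exact: (past_walk (leqnn n)).
have mX' : measurable_fun setT X.
  by move=> _ A mA; apply: (@past_measurable n); exact: mX.
have mY : measurable_fun setT Y.
  by apply: measurableT_comp => //; apply: measurable_funM.
transitivity (\int[P]_w (X w * Y w)%:E)%E.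
  apply: eq_integral => w _; congr EFin.
  by rewrite /X /Y walkS mulrDr expRD mulrAC.
rewrite expectation_mul_indep//; first by rewrite mgf1 mule1.
- by move=> w; rewrite mulr_ge0 ?expR_ge0.
- by move=> w; rewrite expR_ge0.
- move=> A B mA mB.
  have -> : Y @^-1` B = xi n @^-1` ((fun y => expR (th * y)) @^-1` B) by [].
  apply: independent_past => //.
    rewrite -[X in measurable X]setTI.
    have : measurable_fun [set: R] (fun y : R => expR (th * y)).
      by apply: measurableT_comp => //; apply: measurable_funM.
    exact.
  by have := mX measurableT A mA; rewrite setTI.
Qed.

(** Puts mass and crossing probability under one integral, so that both crossing bounds reduce to
    pointwise inequalities. *)
Lemma stopped_massD n (c : R) (f : T -> R) : 0 <= c -> measurable_fun setT f ->
  (\int[P]_w (expR (th * f w) * \1_(walk_below n) w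
              + c * \1_(~` walk_below n) w)%:E =
   \int[P]_w (expR (th * f w) * \1_(walk_below n) w)%:E
   + c%:E * P (~` walk_below n))%E.
Proof.
move=> c0 mf; have mA := measurable_walk_below n.
have mAc : measurable (~` walk_below n) by exact: measurableC.
under eq_integral do rewrite EFinD.
rewrite ge0_integralD//.
- congr (_ + _)%E; under eq_integral do rewrite EFinM.
  rewrite ge0_integralZl//; first by rewrite integral_indic// setIT.
  by apply/measurable_EFinP; exact: measurable_indic.
- apply/measurable_EFinP; apply: measurable_funM; last exact: measurable_indic.
  by apply: measurableT_comp => //; apply: measurable_funM.
- by move=> w _; rewrite lee_fin mulr_ge0.
- by apply/measurable_EFinP; apply: measurable_funM => //;
    exact: measurable_indic.
Qed.

Lemma stopped_mass0 : stopped_mass 0 = 1%E.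
Proof.
rewrite /stopped_mass walk_below0 -[RHS](probability_setT P) -[in RHS](setTI
  setT).
rewrite -integral_indic//; apply: eq_integral => w _.
by rewrite /walk big_ord0 mulr0 expR0 mul1r.
Qed.

Let mexp n m c : measurable_fun setT (fun w =>
  (expR (th * walk n w) * \1_(walk_below m) w
   + c * \1_(~` walk_below m) w)%:E).
Proof.
apply/measurable_EFinP; apply: measurable_funD; apply: measurable_funM => //.
- apply: measurableT_comp => //; apply: measurable_funM => //.
  exact: measurable_walk.
- exact/measurable_indic/measurable_walk_below.
- exact/measurable_indic/measurableC/measurable_walk_below.
Qed.

Lemma walk_exceed_ub n : 0 <= th ->
  (stopped_mass n + (expR (th * x))%:E * P (~` walk_below n) <= 1)%E.
Proof.
move=> th0; elim: n => [|n IH].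
  by rewrite stopped_mass0 walk_below0 setCT measure0 mule0 adde0.
apply: le_trans IH; rewrite -(stopped_massS n) [stopped_mass _]/stopped_mass
  -!stopped_massD ?expR_ge0//; first last.
- exact: measurable_walk.
- exact: measurable_walk.
apply: ge0_le_integral => //.
move=> w _; rewrite lee_fin walk_belowS setCI !indicE !in_setU !in_setC
  !in_setI.
case: (w \in walk_below n) => /=; last by rewrite !mulr0 !mulr1.
case: (boolP (w \in _)); rewrite ?notin_setE/= ?inE/= ?mulr0 ?mulr1 ?addr0
  ?add0r//.
by move/negP; rewrite -ltNge => /ltW ?; rewrite ler_expR ler_wpM2l.
Qed.

(* When the walk crosses the level [x], either it overshoots by at most [eps],
   or the last increment exceeds [eps]; [a > 0] is a Chernoff parameter for the
   latter event. *)
Lemma walk_exceed_lb n (eps a K : R) : 0 <= th -> 0 <= a -> 0 <= K ->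
  (forall k, \int[P]_w (expR ((th + a) * xi k w - a * eps))%:E <= K%:E)%E ->
  (1 <= stopped_mass n + (expR (th * (x + eps)))%:E * P (~` walk_below n)
        + (n%:R * (expR (th * x) * K))%:E)%E.
Proof.
move=> th0 a0 K0 HK; elim: n => [|n IH].
  by rewrite stopped_mass0 walk_below0 setCT measure0 mule0 mul0r !adde0.
apply: (le_trans IH); rewrite -natr1 mulrDl mul1r EFinD addeA addeAC.
apply: leeD2r.
have mxi : measurable_fun setT (fun w =>
    (expR (th * x) * expR ((th + a) * xi n w - a * eps))%:E).
  apply/measurable_EFinP; apply: measurable_funM => //.
  apply: measurableT_comp => //; apply: measurable_funB => //.
  exact: measurable_funM.
apply: (@le_trans _ _ (stopped_mass n.+1 +
  (expR (th * (x + eps)))%:E * P (~` walk_below n.+1) +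
  \int[P]_w (expR (th * x) * expR ((th + a) * xi n w - a * eps))%:E)%E);
    last first.
  apply: leeD2l; under eq_integral do rewrite EFinM.
  rewrite ge0_integralZl//.
  - by rewrite EFinM lee_wpmul2l// lee_fin expR_ge0.
  - apply/measurable_EFinP.
    apply: measurableT_comp => //; apply: measurable_funB => //.
    exact: measurable_funM.
rewrite -(stopped_massS n) [stopped_mass _]/stopped_mass -!stopped_massD
  ?expR_ge0//; first last.
- exact: measurable_walk.
- exact: measurable_walk.
rewrite -ge0_integralD//.
apply: ge0_le_integral => //.
- exact: emeasurable_funD.
move=> w _; rewrite -EFinD lee_fin.
rewrite walk_belowS setCI !indicE !in_setU !in_setC !in_setI.
case: (boolP (w \in walk_below n)) => [|_] /=; last first.
  by rewrite !mulr0 !mulr1 !add0r lerDl mulr_ge0 ?expR_ge0.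
rewrite inE => /(_ n (leqnn n)) wn.
case: (boolP (w \in _)); rewrite ?notin_setE/= ?inE/= ?mulr0 ?mulr1 ?addr0
  ?add0r//.
  by move=> _; rewrite lerDl mulr_ge0 ?expR_ge0.
move=> _; rewrite walkS.
have [xe|ex] := leP (xi n w) eps.
  apply: (@le_trans _ _ (expR (th * (x + eps)))).
    by rewrite ler_expR ler_wpM2l// lerD.
  by rewrite lerDl mulr_ge0 ?expR_ge0.
apply: (@le_trans _ _ (expR (th * x) * expR ((th + a) * xi n w - a * eps))).
  rewrite -expRD ler_expR.
  have h1 : th * walk n w <= th * x by rewrite ler_wpM2l.
  have h2 : a * eps <= a * xi n w by rewrite ler_wpM2l// ltW.
  lra.
by rewrite lerDr expR_ge0.
Qed.

End walk.

(** * The supremum of Brownian motion with drift *)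

Section exceedance.
Context (T : Type) (R : realType).

Definition exceeds (X : R -> T -> R) (x : R) : set T :=
  [set w | exists2 s : R, 0 < s & x < X s w - s].

Definition exceeds_grid (X : R -> T -> R) (x : R) (m : nat) : set T :=
  [set w | exists2 k, (0 < k <= m ^ 3)%N &
    x < X (k%:R * (m%:R ^+ 2)^-1) w - k%:R * (m%:R ^+ 2)^-1].

(** By continuity a strict exceedance at [s] persists just after [s], hence at the first grid point
    beyond [s] once the mesh is small. The grids are not nested, which is why a limit inferior of
    events appears instead of an increasing union. *)
Lemma exceeds_gridE (X : R -> T -> R) (x : R) :
  (forall w, {within [set t : R | 0 <= t], continuous (X ^~ w)}) ->
  exceeds X x = \bigcup_K \bigcap_(m in [set m | (K < m)%N]) exceeds_grid X x m.
Proof.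
move=> cX; apply/seteqP; split => [w [s s0 xs]|w [K _ /(_ K.+1 (ltnSn K))]];
  last first.
  move=> [k /andP[k0 _] xk]; exists (k%:R * (K.+1%:R ^+ 2)^-1) => //.
  by rewrite mulr_gt0 ?ltr0n// invr_gt0 exprn_gt0 ?ltr0n.
have [e /= e0 He] : exists2 e : R, 0 < e &
    forall t, 0 < t -> `|s - t| < e -> x < X t w - t.
  have : {for s, continuous (X ^~ w)}.
    have so : s \in [set t : R | 0 < t] by rewrite inE.
    have oo : open [set t : R | 0 < t] by exact: open_gt.
    have : {within [set t : R | 0 < t], continuous (X ^~ w)}.
      by apply: continuous_subspaceW (cX w) => t /= /ltW.
    by rewrite continuous_open_subspace// => /(_ s so).
  move=> cs.
  have : X t w - t @[t --> s] --> X s w - s by apply: cvgB => //; exact: cvg_id.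
  move=> /cvgr_gt /(_ _ xs) /nbhs_ballP[e /= e0 be].
  by exists e => // t _ st; exact: be.
(* The first bound keeps the chosen grid point within the [m ^ 3] available ones, the second makes
   the mesh smaller than [e]. *)
pose K := maxn (Num.truncn (s + 1)) (Num.truncn e^-1); exists K => // m /= Km.
have [K1 K2] : (Num.truncn (s + 1) < m)%N /\ (Num.truncn e^-1 < m)%N.
  by split; apply: leq_ltn_trans Km; rewrite ?leq_maxl ?leq_maxr.
have m0 : (0 < m)%N by exact: leq_ltn_trans K1.
have mR0 : 0 < m%:R :> R by rewrite ltr0n.
have sm : s + 1 <= m%:R by rewrite (le_trans (ltW (truncnS_gt _)))// ler_nat.
have em : e^-1 < m%:R by rewrite (lt_le_trans (truncnS_gt _))// ler_nat.
have m2e : (m%:R ^+ 2)^-1 < e.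
  rewrite invf_plt ?posrE ?exprn_gt0//; apply: lt_le_trans em _.
  by rewrite expr2 ler_peMr// ?ler1n// ltW.
have sm0 : 0 <= s * m%:R ^+ 2 by rewrite mulr_ge0 ?exprn_ge0 ?ltW.
have /andP[ks sk] := truncn_itv sm0.
(* The successor is taken so that the grid point lies strictly after [s], hence at a positive index
   and at distance at most one mesh. *)
set k := Num.truncn _ in ks sk; exists k.+1.
  rewrite /= -(ler_nat R) -natr1 natrX.
  have m3 : (s + 1) * m%:R ^+ 2 <= m%:R ^+ 3.
    by rewrite exprS ler_wpM2r// exprn_ge0// ltW.
  have m1 : 1 <= m%:R ^+ 2 :> R by rewrite exprn_ege1// ler1n.
  lra.
set t := _ * _.
have tm : t * m%:R ^+ 2 = k.+1%:R by rewrite /t mulfVK// expf_neq0// gt_eqF.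
have m20 : 0 < m%:R ^+ 2 :> R by rewrite exprn_gt0.
apply: He; first by rewrite -(pmulr_lgt0 _ m20) tm.
have st : s < t by rewrite -(ltr_pM2r m20) tm.
rewrite ltr0_norm ?subr_lt0// opprB; apply: le_lt_trans m2e.
rewrite lerBlDr -(ler_pM2r m20) tm mulrDl mulVf ?gt_eqF// -natr1.
by rewrite addrC lerD2l.
Qed.

End exceedance.

Section measure_facts.
Context d (T : measurableType d) (R : realType) (P : probability T R).

Lemma ae_eq_measure (A B : set T) : measurable A -> measurable B ->
  {ae P, forall w, A w <-> B w} -> P A = P B.
Proof.
move=> mA mB AB; rewrite -[A]setIT -[B]setIT -!integral_indic//.
apply: ae_eq_integral => //; try exact/measurable_EFinP/measurable_indic.
apply: filterS AB => w AB _; congr EFin; rewrite !indicE.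
by congr (_%:R); congr nat_of_bool; apply/idP/idP; rewrite !inE => /AB.
Qed.

Lemma measure_liminf_le (B : (set T)^nat) (c : \bar R) :
  (forall m, measurable (B m)) -> (forall m, (0 < m)%N -> P (B m) <= c)%E ->
  (P (\bigcup_K \bigcap_(m in [set m | (K < m)%N]) B m) <= c)%E.
Proof.
move=> mB Bc.
pose C K := \bigcap_(m in [set m | (K < m)%N]) B m.
have mC K : measurable (C K) by apply: bigcap_measurableType.
have ndC : nondecreasing_seq C.
  move=> K L KL; apply/subsetPset => w Cw m /= Lm; apply: Cw.
  exact: leq_ltn_trans Lm.
have := nondecreasing_cvg_mu (mu := P) mC (bigcupT_measurable _ mC) ndC.
move=> /cvg_lim <-//; apply: lime_le.
  by apply: ereal_nondecreasing_is_cvgn => K L KL; apply: le_measure;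
    rewrite ?inE//; exact/subsetPset/ndC.
apply: nearW => K; apply: le_trans (Bc K.+1 isT).
by apply: le_measure; rewrite ?inE// => w; apply => /=.
Qed.

End measure_facts.

Section measurable_exceedance.
Context d (T : measurableType d) (R : realType) (X : R -> T -> R).
Hypothesis mX : forall t, 0 <= t -> measurable_fun setT (X t).

Lemma measurable_exceeds_grid (x : R) m : measurable (exceeds_grid X x m).
Proof.
have -> : exceeds_grid X x m =
    \bigcup_(k in [set k | (0 < k <= m ^ 3)%N])
      (X (k%:R * (m%:R ^+ 2)^-1) @^-1` `]x + k%:R * (m%:R ^+ 2)^-1, +oo[).
  apply/seteqP; split => w [k km].
    by move=> h; exists k => //=; rewrite in_itv/= andbT -ltrBrDr.
  by rewrite /= in_itv/= andbT -ltrBrDr => h; exists k.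
apply: bigcup_measurable => k _; rewrite -[X in measurable X]setTI.
by apply: mX => //; rewrite mulr_ge0// invr_ge0 exprn_ge0.
Qed.

Hypothesis cX : forall w, {within [set t : R | 0 <= t], continuous (X ^~ w)}.

Lemma measurable_exceeds (x : R) : measurable (exceeds X x).
Proof.
rewrite exceeds_gridE//; apply: bigcup_measurable => K _.
by apply: bigcap_measurableType => m _; exact: measurable_exceeds_grid.
Qed.

Let unbounded : set T := \bigcap_n exceeds X n%:R.

Let measurable_unbounded : measurable unbounded.
Proof. by apply: bigcap_measurableType => n _; exact: measurable_exceeds. Qed.

(** Paths unbounded above exceed every level but have real supremum 0, so they are removed from
    [exceeds] and put back exactly for [x < 0]. *)
Lemma sup_drifted_gtE (x : R) :
  [set w | x < sup_drifted X w] =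
  (exceeds X x `\` unbounded) `|` (if x < 0 then unbounded else set0).
Proof.
have sup0 w : unbounded w -> sup_drifted X w = 0.
  move=> Uw; apply: sup_out => -[_ [M HM]].
  have [s s0] := Uw (Num.truncn `|M|).+1 I; apply/negP; rewrite -leNgt.
  rewrite (@le_trans _ _ M)//; first by apply: HM; exists s.
  by rewrite (le_trans (ler_norm _))// ltW// truncnS_gt.
apply/seteqP; split => w; have [Uw|Uw] := pselect (unbounded w).
- by rewrite /= sup0// => ->; right.
- move=> xw; left; split => //.
  have ne : [set X s w - s | s in [set s | 0 < s]] !=set0.
    by exists (X 1 w - 1); exists 1 => //=.
  by have [_ [s s0 <-] xs] := sup_gt ne xw; exists s.
- by case=> [[//]|]; case: ifP => // x0 _; rewrite /= sup0.
- case=> [[[s s0 xs] _]|]; last by case: ifP.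
  rewrite /= (lt_le_trans xs)//; apply: ub_le_sup; last by exists s.
  move: Uw => /existsNP[n /not_implyP[_ Un]]; exists n%:R => _ [t t0 <-].
  by rewrite leNgt; apply/negP => nt; apply: Un; exists t.
Qed.

Lemma measurable_sup_drifted : measurable_fun setT (sup_drifted X).
Proof.
apply: (measurability _ (RGenOInfty.measurableE R)) => _ [_ [x ->] <-].
rewrite setTI (_ : _ @^-1` _ = [set w | x < sup_drifted X w]); last first.
  by apply/seteqP; split => w /=; rewrite in_itv/= andbT.
rewrite sup_drifted_gtE; apply: measurableU; last by case: ifP.
by apply: measurableD => //; exact: measurable_exceeds.
Qed.

End measurable_exceedance.

Section real_bounds.
Context {R : realType}.

(** Stands in for a limit in [m]: the error terms below are all brought to the form [C / m]. *)
Lemma le0_archi (r C : R) :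
  (forall m, (0 < m)%N -> r <= C / m%:R) -> r <= 0.
Proof.
move=> H; rewrite leNgt; apply/negP => r0.
have := H _ (ltn0Sn (Num.truncn (`|C| / r))); apply/negP; rewrite -ltNge.
rewrite ltr_pdivrMr ?ltr0n// mulrC -ltr_pdivrMr//.
by apply: le_lt_trans (truncnS_gt _); rewrite ler_pM2r ?invr_gt0// ler_norm.
Qed.

Lemma expRN_le (y : R) : 0 < y -> expR (- y) <= y^-1.
Proof.
move=> y0; rewrite expRN lef_pV2 ?posrE ?expR_gt0//.
by apply: le_trans (expR_ge1Dx _); rewrite lerDr.
Qed.

End real_bounds.

(** * Exponential law of the supremum *)

Section brownian_supremum.
Context d (T : measurableType d) (R : realType) (P : probability T R).
Variables (sigma : R) (W : R -> {RV P >-> R}).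
Hypothesis sigma_gt0 : 0 < sigma.
Hypothesis W_bm : brownian_motion sigma W.

Local Notation th := (2 / sigma ^+ 2).

Lemma exp_rate_gt0 : 0 < th.
Proof. by rewrite divr_gt0// exprn_gt0. Qed.

Lemma brownian_mgf (s t u : R) : 0 <= s -> s < t ->
  (\int[P]_w (expR (u * (W t w - W s w)))%:E =
   (expR (u ^+ 2 * sigma ^+ 2 * (t - s) / 2))%:E)%E.
Proof.
move=> s0 st; have [_ Wn _ _] := W_bm.
have mf : measurable_fun [set: R] (fun y => (expR (u * y))%:E).
  by apply/measurable_EFinP; apply: measurableT_comp.
have mD : measurable_fun setT ((W t \- W s)%R : T -> measurableTypeR R).
  exact: measurable_funB.
have mf' : measurable_fun setT
    ((fun y => (expR (u * y))%:E) : measurableTypeR R -> \bar R) by exact: mf.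
have f0 : {in setT, forall y : measurableTypeR R, (0 <= (expR (u * y))%:E)%E}.
  by move=> y _; rewrite lee_fin expR_ge0.
rewrite -(ge0_integral_pushforward mD P measurableT mf' f0).
rewrite (eq_measure_integral (normal_prob 0 (sigma * Num.sqrt (t - s))));
  last first.
  by move=> A mA _; apply/esym; rewrite -[LHS]Wn.
rewrite normal_mgf; last by rewrite mulf_neq0 ?gt_eqF// sqrtr_gt0 subr_gt0.
by rewrite exprMn sqr_sqrtr ?mulrA// subr_ge0 ltW.
Qed.

Definition drift_step (h : R) (k : nat) : {RV P >-> R} :=
  (W (k.+1%:R * h) \- W (k%:R * h) \- cst h)%R.

Lemma drift_step_indep (h : R) : 0 < h ->
  independent_variables P (fun k => drift_step h k : T -> R).
Proof.
move=> h0; have [_ _ Wi _] := W_bm.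
have t0 : 0 <= 0%:R * h by rewrite mul0r.
have t_nd : {homo (fun k : nat => k%:R * h) : m n / (m <= n)%N >-> m <= n}.
  by move=> m n mn; rewrite ler_pM2r// ler_nat.
move=> J E HE; apply: (Wi (fun k => k%:R * h) t0 t_nd J E) => k /HE[A mA <-].
exists ((fun y => y - h) @^-1` A) => //.
rewrite -[X in measurable X]setTI.
have : measurable_fun [set: R] (fun y => y - h) by exact: measurable_funB.
exact.
Qed.

Lemma drift_walkE (h : R) n w :
  walk (drift_step h) n w = W (n%:R * h) w - W 0 w - n%:R * h.
Proof.
elim: n => [|n IH]; first by rewrite /walk big_ord0 !mul0r !subrr.
by rewrite walkS IH /= -natr1; ring.
Qed.

(** Since [sigma ^+ 2 / 2] is the inverse of [th], the exponent vanishes at [u = th], which yields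
    the martingale, and is negative at [u = th / 2], which makes the mass of the uncrossed paths
    decay. *)
Lemma drift_step_mgf (h u : R) k : 0 < h ->
  (\int[P]_w (expR (u * drift_step h k w))%:E =
   (expR (h * (u ^+ 2 / th - u)))%:E)%E.
Proof.
move=> h0.
have kh : k%:R * h < k.+1%:R * h by rewrite ltr_pM2r// ltr_nat.
transitivity (\int[P]_w ((expR (- (u * h)))%:E *
    (expR (u * (W (k.+1%:R * h) w - W (k%:R * h) w)))%:E))%E.
  by apply: eq_integral => w _; rewrite -EFinM -expRD /=; congr (expR _)%:E;
    ring.
rewrite ge0_integralZl ?lee_fin ?expR_ge0//; last first.
- apply/measurable_EFinP; apply: measurableT_comp => //.
  by apply: measurable_funM => //; exact: measurable_funB.
rewrite brownian_mgf//; last by rewrite mulr_ge0// ltW.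
rewrite -EFinM -expRD; congr (expR _)%:E.
by rewrite -natr1; field; rewrite ?gt_eqF// ?exprn_gt0.
Qed.

Lemma brownian_walk_mgf (h u : R) n : 0 < h -> (0 < n)%N ->
  (\int[P]_w (expR (u * walk (drift_step h) n w))%:E =
   (expR (n%:R * h * (u ^+ 2 / th - u)))%:E)%E.
Proof.
move=> h0 n0; have nh : 0 < n%:R * h by rewrite mulr_gt0// ltr0n.
transitivity (\int[P]_w ((expR (- (u * (n%:R * h))))%:E *
    (expR (u * (W (n%:R * h) w - W 0 w)))%:E))%E.
  apply: eq_integral => w _; rewrite -EFinM -expRD drift_walkE.
  by congr (expR _)%:E; ring.
rewrite ge0_integralZl ?lee_fin ?expR_ge0//; last first.
- apply/measurable_EFinP; apply: measurableT_comp => //.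
  by apply: measurable_funM => //; exact: measurable_funB.
rewrite brownian_mgf//.
rewrite -EFinM -expRD; congr (expR _)%:E.
by field; rewrite ?gt_eqF// ?exprn_gt0.
Qed.

Lemma exceeds_grid_prob (x : R) m : 0 <= x -> (0 < m)%N ->
  P (exceeds_grid W x m) =
  P (~` walk_below (drift_step (m%:R ^+ 2)^-1) x (m ^ 3)).
Proof.
move=> x0 m0; have [W0 _ _ _] := W_bm.
apply: ae_eq_measure.
- exact: measurable_exceeds_grid.
- exact/measurableC/measurable_walk_below.
apply: filterS W0 => w W0; split.
  move=> [k /andP[k0 km] xk] /(_ k km).
  by rewrite drift_walkE W0 subr0 leNgt xk.
apply: contra_notP => Bw k km; rewrite leNgt; apply/negP.
rewrite drift_walkE W0 subr0 => xk; apply: Bw; exists k => //.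
(* The grid event omits index 0 while [walk_below] includes it; at time 0 the process is 0, which
   does not exceed [x]. *)
rewrite km andbT lt0n; apply/eqP => k0; move: xk.
by rewrite k0 mul0r subr0 W0 ltNge x0.
Qed.


Lemma drift_step_mgf1 (h : R) k : 0 < h ->
  (\int[P]_w (expR (th * drift_step h k w))%:E = 1)%E.
Proof.
move=> h0; rewrite drift_step_mgf//; have th0 := exp_rate_gt0.
suff -> : th ^+ 2 / th - th = 0 by rewrite mulr0 expR0.
by rewrite expr2 mulfK ?gt_eqF// subrr.
Qed.

Lemma exceeds_grid_ub (x : R) m : 0 <= x -> (0 < m)%N ->
  (P (exceeds_grid W x m) <= (expR (- (th * x)))%:E)%E.
Proof.
move=> x0 m0; have th0 := exp_rate_gt0.
have h0 : 0 < (m%:R ^+ 2)^-1 :> R by rewrite invr_gt0 exprn_gt0// ltr0n.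
rewrite exceeds_grid_prob//.
have := walk_exceed_ub (drift_step_indep h0) x0
  (fun k => drift_step_mgf1 k h0) (m ^ 3) (ltW th0).
set A := walk_below _ _ _ => H.
rewrite expRN -[leRHS]mule1 lee_pdivlMl ?expR_gt0//.
apply: le_trans H; rewrite leeDr//; apply: integral_ge0 => w _.
by rewrite lee_fin mulr_ge0 ?expR_ge0.
Qed.

Let measurable_exceedsW (x : R) : measurable (exceeds W x).
Proof. by have [_ _ _ cW] := W_bm; exact: measurable_exceeds. Qed.

Lemma exceeds_ub (x : R) : 0 <= x ->
  (P (exceeds W x) <= (expR (- (th * x)))%:E)%E.
Proof.
move=> x0; have [_ _ _ cW] := W_bm; rewrite exceeds_gridE//.
apply: measure_liminf_le => m; first exact: measurable_exceeds_grid.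
exact: exceeds_grid_ub.
Qed.

(** The three terms are the mass still below the level at time [m], the crossings with overshoot at
    most [eps], and the large last increments over [m ^ 3] steps. The Chernoff parameter is [m]:
    increments have standard deviation [sigma / m], so their exponential moment of order [th + m]
    stays bounded, with exponent [m^-1 + th^-1]. *)
Lemma exceeds_grid_lb (x eps : R) m : 0 <= x -> (0 < m)%N ->
  1 <= expR (th * x / 2 - m%:R * th / 4)
       + expR (th * (x + eps)) * fine (P (exceeds W x))
       + m%:R ^+ 3 * (expR (th * x) * expR (1 + th^-1 - m%:R * eps)).
Proof.
move=> x0 m0; have th0 := exp_rate_gt0.
have mR0 : 0 < m%:R :> R by rewrite ltr0n.
have h0 : 0 < (m%:R ^+ 2)^-1 :> R by rewrite invr_gt0 exprn_gt0.
have m30 : (0 < m ^ 3)%N by rewrite expn_gt0 m0.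
have HK k : (\int[P]_w (expR ((th + m%:R) * drift_step (m%:R ^+ 2)^-1 k w
      - m%:R * eps))%:E <= (expR (1 + th^-1 - m%:R * eps))%:E)%E.
  under eq_integral do rewrite addrC expRD EFinM.
  rewrite ge0_integralZl ?lee_fin ?expR_ge0//; last first.
    apply/measurable_EFinP; apply: measurableT_comp => //.
    by apply: measurable_funM.
  rewrite drift_step_mgf// -EFinM -expRD lee_fin ler_expR addrC lerD2r.
  have -> : (m%:R ^+ 2)^-1 * ((th + m%:R) ^+ 2 / th - (th + m%:R)) =
      m%:R^-1 + th^-1.
    by field; rewrite ?gt_eqF// ?exprn_gt0.
  by rewrite lerD2r invf_le1// ler1n.
have := walk_exceed_lb (drift_step_indep h0) x0
  (fun k => drift_step_mgf1 k h0) (m ^ 3) (ltW th0) (ltW mR0) (expR_ge0 _) HK.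
rewrite -exceeds_grid_prob// => H.
have mE := measurable_exceedsW x.
rewrite -lee_fin !EFinD [X in (_ + X + _)%E]EFinM fineK ?fin_num_measure//.
apply: le_trans H _; rewrite natrX leeD2r// leeD//; last first.
  rewrite lee_wpmul2l ?lee_fin ?expR_ge0//; apply: le_measure; rewrite ?inE//.
    exact: measurable_exceeds_grid.
  move=> w [k /andP[k0 _] xk]; exists (k%:R * (m%:R ^+ 2)^-1) => //.
  by rewrite mulr_gt0// ltr0n.
(* Below the level, half of the exponent is bounded by [th * x / 2]. The other half has parameter
   [th / 2], for which the mean at time [m] is [expR (- (m * th / 4))]. *)
apply: (@le_trans _ _ (\int[P]_w ((expR (th * x / 2))%:E *
    (expR (th / 2 * walk (drift_step (m%:R ^+ 2)^-1) (m ^ 3) w))%:E))%E).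
  apply: ge0_le_integral => //.
  - apply/measurable_EFinP; apply: measurable_funM.
      apply: measurableT_comp => //; apply: measurable_funM => //.
      exact: measurable_walk.
    exact/measurable_indic/measurable_walk_below.
  - apply/measurable_EFinP; apply: measurable_funM => //.
    apply: measurableT_comp => //; apply: measurable_funM => //.
    exact: measurable_walk.
  move=> w _; rewrite -EFinM lee_fin indicE; case: (boolP (w \in _)).
    rewrite inE => /(_ (m ^ 3)%N (leqnn _)) wx.
    rewrite mulr1 -expRD ler_expR.
    have := ler_wpM2l (ltW th0) wx; lra.
  by rewrite mulr0 mulr_ge0 ?expR_ge0.
rewrite ge0_integralZl ?lee_fin ?expR_ge0//; last first.
  apply/measurable_EFinP; apply: measurableT_comp => //;
    apply: measurable_funM => //.
  exact: measurable_walk.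
rewrite brownian_walk_mgf// -EFinM -expRD lee_fin ler_expR natrX.
by rewrite le_eqVlt; apply/orP; left; apply/eqP; field; rewrite ?gt_eqF.
Qed.

Lemma exceeds_prob (x : R) : 0 <= x ->
  P (exceeds W x) = (expR (- (th * x)))%:E.
Proof.
move=> x0; have th0 := exp_rate_gt0.
apply/eqP; rewrite eq_le exceeds_ub//=.
have mE := measurable_exceedsW x.
rewrite -(fineK (fin_num_measure P _ mE)) lee_fin.
set p := fine _.
have step eps : 0 < eps -> 1 <= expR (th * (x + eps)) * p.
  move=> e0; rewrite -subr_le0.
  (* The two parts come from [exp (- y) <= 1 / y] at [y = m * th / 4] and from
     [exp (- y) <= 4! / y ^ 4] at [y = m * eps]; the fourth power beats the [m ^ 3] steps by one
     factor [m]. *)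
  pose C := expR (th * x / 2) * (4 / th) +
            expR (th * x) * expR (1 + th^-1) * (24 / eps ^+ 4).
  apply: (le0_archi (C := C)) => m m0;
    have mR0 : 0 < m%:R :> R by rewrite ltr0n.
  have := exceeds_grid_lb eps x0 m0; rewrite -/p -addrA addrCA -lerBlDl.
  move=> /le_trans; apply; rewrite /C [leRHS]mulrDl.
  have expN4 (y : R) : 0 < y -> expR (- y) <= 24 / y ^+ 4.
    move=> y0; rewrite expRN -[leRHS]invrK lef_pV2 ?posrE ?expR_gt0//;
      last first.
      by rewrite invr_gt0 divr_gt0// exprn_gt0.
    have := @expR_ge1Dxn R y 3 (ltW y0); rewrite invf_div; apply: le_trans.
    by rewrite lerDr.
  apply: lerD.
    rewrite expRD -[leRHS]mulrA ler_wpM2l ?expR_ge0//.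
    apply: le_trans (expRN_le _) _; first by rewrite divr_gt0// mulr_gt0.
    by rewrite le_eqVlt; apply/orP; left; apply/eqP; field; rewrite ?gt_eqF.
  rewrite [expR (1 + _ - _)]expRD mulrCA [X in _ * X <= _]mulrCA.
  rewrite [leLHS]mulrA -[leRHS]mulrA ler_wpM2l ?mulr_ge0 ?expR_ge0//.
  have me : 0 < m%:R * eps by rewrite mulr_gt0.
  apply: (@le_trans _ _ (m%:R ^+ 3 * (24 / (m%:R * eps) ^+ 4))).
    by rewrite ler_wpM2l ?exprn_ge0//; exact: expN4.
  by rewrite le_eqVlt; apply/orP; left; apply/eqP; field; rewrite ?gt_eqF.
(* The grid limit is done for each fixed [eps]; now [eps = 1 / m] tends to 0. *)
rewrite -subr_le0; apply: (le0_archi (C := expR (- (th * x)) * th)) => m m0.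
have mR0 : 0 < m%:R :> R by rewrite ltr0n.
have := step m%:R^-1; rewrite invr_gt0 => /(_ mR0).
rewrite mulrDr expRD -mulrA mulrCA => H.
have {}H : expR (- (th * x)) * expR (- (th / m%:R)) <= p.
  rewrite !expRN -invfM -[leLHS]mulr1 mulrC ler_pdivrMr ?mulr_gt0 ?expR_gt0//.
  by rewrite [leRHS]mulrC -[leRHS]mulrA [X in _ <= X]mulrCA.
rewrite lerBlDr; apply: le_trans (lerD (lexx _) H).
rewrite -[expR (- (th * x)) * th / _]mulrA -mulrDr ler_peMr ?expR_ge0//.
have := expR_ge1Dx (- (th / m%:R)); lra.
Qed.


Lemma sup_drifted_ccdf (x : R) : 0 <= x ->
  P [set w | x < sup_drifted W w] = (expR (- (th * x)))%:E.
Proof.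
move=> x0; have th0 := exp_rate_gt0; have [_ _ _ cW] := W_bm.
rewrite sup_drifted_gtE// ltNge x0 /= setU0.
set U := \bigcap_n _.
have mU : measurable U by apply: bigcap_measurableType.
have U0 : P U = 0%E.
  apply/eqP; rewrite eq_le measure_ge0 andbT.
  rewrite -(fineK (fin_num_measure P _ mU)) lee_fin.
  apply: (le0_archi (C := th^-1)) => m m0.
  rewrite -lee_fin fineK ?fin_num_measure//.
  apply: (@le_trans _ _ (P (exceeds W m%:R))).
    by apply: le_measure; rewrite ?inE// => w; apply.
  rewrite exceeds_prob// lee_fin; apply: le_trans (expRN_le _) _.
    by rewrite mulr_gt0// ltr0n.
  by rewrite invfM.
have -> : exceeds W x `\` U = exceeds W x `\` (exceeds W x `&` U).
  by rewrite setDIr setDv set0U.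
rewrite measureD//; last 2 first.
- exact: measurableI.
- by rewrite ltey_eq fin_num_measure.
rewrite [X in (_ - X)%E](_ : _ = 0%E) ?sube0; first exact: exceeds_prob.
apply/eqP; rewrite eq_le measure_ge0 andbT -U0 le_measure ?inE//.
- by apply: measurableI => //; exact: measurableI.
- by move=> w [_ []].
Qed.

End brownian_supremum.

(** * The maximum of the suprema *)

Definition max_exp_ccdf (R : realType) (rate : R) (N : nat) (x : R) : R :=
  if 0 <= x then 1 - (1 - expR (- (rate * x))) ^+ N else 1.

Section maximum.
Context d (T : measurableType d) (R : realType) (P : probability T R).
Variables (sigma : R) (W : nat -> R -> {RV P >-> R}).
Hypothesis sigma_gt0 : 0 < sigma.
Hypothesis W_bm : forall i, brownian_motion sigma (W i).
Hypothesis W_indep : independent_processes P (fun i t => W i t : T -> R).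

Local Notation th := (2 / sigma ^+ 2).
Local Notation Q i := (sup_drifted (fun t => W i t : T -> R)).

Lemma measurable_sup_drifted_bm i : measurable_fun setT (Q i).
Proof. by have [_ _ _ cW] := W_bm i; exact: measurable_sup_drifted. Qed.

(** Independence is assumed for the sigma-algebras of the processes. Measurability of the supremum
    holds for any sigma-algebra that measures the process at times [t >= 0], so it applies to the
    generated one. *)
Lemma sup_drifted_sigma_of i (x : R) :
  sigma_of [set t | 0 <= t] (fun t => W i t : T -> R) [set w | Q i w <= x].
Proof.
have [_ _ _ cW] := W_bm i.
pose G := \bigcup_(t in [set t : R | 0 <= t])
  preimage_set_system setT (W i t : T -> R) measurable.
have mQ : measurable_fun setT (Q i : g_sigma_algebraType G -> R).
  apply: measurable_sup_drifted => // t t0 _ A mA.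
  by apply: sub_sigma_algebra; exists t => //; exists A.
have := mQ measurableT _ (measurable_itv `]-oo, x]); rewrite setTI.
by rewrite (_ : _ @^-1` _ = [set w | Q i w <= x])//; apply/seteqP;
  split => w /=;
  rewrite in_itv.
Qed.

Let measurable_le (X : T -> R) (x : R) : measurable_fun setT X ->
  measurable [set w | X w <= x].
Proof.
move=> mX; rewrite (_ : [set w | X w <= x] = X @^-1` `]-oo, x]).
  by rewrite -[S in measurable S]setTI; exact: mX.
by apply/seteqP; split => w /=; rewrite in_itv.
Qed.

Let ccdf_le (X : T -> R) (x : R) : measurable_fun setT X ->
  P [set w | x < X w] = (1 - P [set w | (X w <= x)%R])%E.
Proof.
move=> mX; rewrite -probability_setC//; last exact: measurable_le.
by congr (P _); apply/seteqP; split => w /=; rewrite ltNge => /negP.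
Qed.

Lemma sup_drifted_cdf i (x : R) : 0 <= x ->
  P [set w | Q i w <= x] = (1 - expR (- (th * x)))%:E.
Proof.
move=> x0; have mQ := measurable_sup_drifted_bm i.
have := ccdf_le x mQ; rewrite (sup_drifted_ccdf sigma_gt0 (W_bm i) x0).
rewrite -(fineK (fin_num_measure P _ (measurable_le x mQ))) -EFinB.
by move=> [->]; rewrite opprB addrC subrK.
Qed.

Lemma max_supP N w (x : R) : (0 < N)%N ->
  (max_sup (fun i t => W i t : T -> R) N w <= x) <->
  (forall j, (j < N)%N -> Q j w <= x).
Proof.
move=> N0; rewrite /max_sup; split.
  by move=> /bigmax_leP[_ H] j jN; exact: (H (Ordinal jN)).
by move=> H; apply/bigmax_leP; split => [|j _]; exact: H.
Qed.

Lemma measurable_max_sup N :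
  measurable_fun setT (max_sup (fun i t => W i t : T -> R) N).
Proof.
have mQ := measurable_sup_drifted_bm; rewrite /max_sup.
elim: (index_enum _) => [|j s IH].
  by under eq_fun do rewrite big_nil; exact: mQ.
by under eq_fun do rewrite big_cons; exact: measurable_maxr.
Qed.

Lemma max_sup_ccdf N (x : R) : (0 < N)%N ->
  P [set w | x < max_sup (fun i t => W i t : T -> R) N w] =
  (max_exp_ccdf th N x)%:E.
Proof.
move=> N0; have mM := measurable_max_sup N;
  have mQ := measurable_sup_drifted_bm.
have mlt (X : T -> R) (y : R) : measurable_fun setT X -> measurable [set w | y
  < X w].
  move=> mX; rewrite (_ : [set w | y < X w] = X @^-1` `]y, +oo[).
    by rewrite -[S in measurable S]setTI; exact: mX.
  by apply/seteqP; split => w /=; rewrite in_itv/= andbT.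
rewrite /max_exp_ccdf; have [x0|x0] := leP 0 x; last first.
  apply/eqP; rewrite eq_le probability_le1 /=; last exact: mlt.
  (* A negative level is exceeded almost surely because one single supremum is already positive
     almost surely. *)
  have <- : P [set w | 0 < Q 0%N w] = 1%E.
    by rewrite (sup_drifted_ccdf sigma_gt0 (W_bm 0%N))// mulr0 oppr0 expR0.
  apply: le_measure; rewrite ?inE; [exact: mlt|exact: mlt|].
  move=> w /= Q0; apply: (lt_trans x0); apply: (lt_le_trans Q0).
  exact: (max_supP w _ N0).1 (lexx _) 0%N N0.
rewrite ccdf_le// EFinB; congr (_ - _)%E.
have -> : [set w | max_sup (fun i t => W i t : T -> R) N w <= x] =
    \bigcap_(j in `I_N) [set w | Q j w <= x].
  by apply/seteqP; split => w /max_supP; apply.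
rewrite -set_fset_iota W_indep; last by move=> j _; exact: sup_drifted_sigma_of.
rewrite prod_fset_iota; under eq_bigr do rewrite sup_drifted_cdf//.
by rewrite prodEFin prodr_const card_ord.
Qed.


End maximum.

(** * Mean excess over a level *)

Section mean_excess.
Context {R : realType}.
Local Notation mu := (@lebesgue_measure R).

Lemma measurable_expRN (c K : R) :
  measurable_fun [set: R] (fun r : R => (K * expR (- (c * r)))%:E).
Proof.
apply/measurable_EFinP; apply: measurable_funM => //.
by apply: measurableT_comp => //; apply: measurableT_comp.
Qed.

Lemma integral_expRN (c K : R) : 0 < c -> 0 <= K ->
  (\int[mu]_(r in `[0%R, +oo[) (K * expR (- (c * r)))%:E = (K / c)%:E)%E.
Proof.
move=> c0 K0.
have mf := measurable_expRN c c.
transitivity ((K / c)%:E * \int[mu]_(r in `[0%R, +oo[) (c * expR (- (c *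
  r)))%:E)%E.
  rewrite -ge0_integralZl//.
  - by apply: eq_integral => r _; rewrite -EFinM mulrA divfK ?gt_eqF.
  - exact: measurable_funTS.
  - by move=> r _; rewrite lee_fin mulr_ge0 ?expR_ge0 ?ltW.
  - by rewrite lee_fin divr_ge0// ltW.
rewrite -[RHS]mule1 -(integral_exponential_pdf c0); congr (_ * _)%E.
rewrite integral_mkcond; apply: eq_integral => r _.
rewrite /exponential_pdf !patchE; case: ifPn => // _.
by rewrite mulNr.
Qed.

Context d (T : measurableType d) (P : probability T R).

Definition excess (X : T -> R) (x : R) : T -> R := fun w => Num.max (X w - x) 0.

Definition mean_excess (X : T -> R) (x : R) : R := fine 'E_P[excess X x]%E.

Lemma excess_ge0 (X : T -> R) (x : R) w : 0 <= excess X x w.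
Proof. by rewrite /excess le_max lexx orbT. Qed.

Lemma mean_excess_ge0 (X : T -> R) (x : R) : 0 <= mean_excess X x.
Proof. by rewrite fine_ge0// expectation_ge0// => w; exact: excess_ge0. Qed.

Lemma measurable_excess (X : T -> R) (x : R) :
  measurable_fun setT X -> measurable_fun setT (excess X x).
Proof.
by move=> mX; apply: measurable_maxr => //; exact: measurable_funB.
Qed.

Lemma expectation_excess (X : T -> R) (F : R -> R) (x : R) :
  measurable_fun setT X -> (forall y, P [set w | y < X w] = (F y)%:E) ->
  ('E_P[excess X x] = \int[mu]_(r in `[0%R, +oo[) (F (x + r))%:E)%E.
Proof.
move=> mX FX.
pose Y : {RV P >-> R} := mfun_Sub (mem_set (measurable_excess x mX)).
have -> : ('E_P[excess X x] = 'E_P[Y])%E by [].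
rewrite ge0_expectation_ccdf; last exact: excess_ge0.
apply: eq_integral => r; rewrite inE/= in_itv/= andbT => r0.
rewrite -FX /ccdf /distribution /pushforward; congr (P _).
apply/seteqP; split => w /=; rewrite in_itv/= andbT /excess lt_max ltrBrDl.
  by case/orP => //; rewrite ltNge r0.
by move=> ->.
Qed.

Lemma measurable_ccdf (X : T -> R) (F : R -> R) :
  measurable_fun setT X -> (forall y, P [set w | y < X w] = (F y)%:E) ->
  measurable_fun setT F.
Proof.
move=> mX FX; pose Y : {RV P >-> R} := mfun_Sub (mem_set mX).
apply/measurable_EFinP; have := ccdf_measurable Y; congr measurable_fun.
apply/funext => y /=; rewrite -FX /ccdf /distribution /pushforward; congr (P _).
by apply/seteqP; split => w /=; rewrite in_itv/= andbT.
Qed.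

End mean_excess.

Section mean_excess_bounds.
Context {R : realType} d (T : measurableType d) (P : probability T R).
Variables (X : T -> R) (F : R -> R) (rate C : R).
Hypothesis mX : measurable_fun setT X.
Hypothesis FX : forall y, P [set w | y < X w] = (F y)%:E.
Hypothesis rate_gt0 : 0 < rate.
Hypothesis F_le : forall y, F y <= C * expR (- (rate * y)).

Let F_ge0 y : 0 <= F y.
Proof. by rewrite -lee_fin -FX. Qed.

Let C_ge0 : 0 <= C.
Proof. by have := le_trans (F_ge0 0) (F_le 0);
  rewrite mulr0 oppr0 expR0 mulr1. Qed.

Let mF : measurable_fun setT F.
Proof. exact: measurable_ccdf FX. Qed.

Let mFD x : measurable_fun [set: R] (fun r : R => (F (x + r))%:E).
Proof.
apply/measurable_EFinP; apply: measurableT_comp => //.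
exact: measurable_funD.
Qed.

Lemma mean_excessE x : ('E_P[excess X x] = (mean_excess P X x)%:E)%E.
Proof.
rewrite fineK// ge0_fin_numE; last by apply: expectation_ge0 => w;
  exact: excess_ge0.
rewrite (expectation_excess _ mX FX).
apply: (@le_lt_trans _ _ (C * expR (- (rate * x)) / rate)%:E); last exact: ltry.
rewrite -integral_expRN ?mulr_ge0 ?expR_ge0//; apply: ge0_le_integral => //.
- by move=> r _; rewrite lee_fin.
- exact: (measurable_funTS (mFD x)).
- exact: (measurable_funTS (measurable_expRN _ _)).
- move=> r _; rewrite lee_fin; apply: le_trans (F_le _) _.
  by rewrite mulrDr opprD expRD mulrA.
Qed.

Lemma integrable_excess x : P.-integrable setT (EFin \o excess X x).
Proof.
have mY := measurable_excess x mX.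
apply/integrableP; split; first exact/measurable_EFinP.
under eq_integral do rewrite /= ger0_norm ?excess_ge0//.
have := mean_excessE x; rewrite unlock => ->; exact: ltry.
Qed.

(** Pointwise, the two excesses differ by at least [y - x] when [X > y], by at most [y - x] when
    [X > x], and by 0 otherwise. This replaces differentiation of the mean excess, whose slope is
    minus the tail. *)
Lemma mean_excess_diff x y : x <= y ->
  (y - x) * F y <= mean_excess P X x - mean_excess P X y <= (y - x) * F x.
Proof.
move=> xy; have mlt z : measurable [set w | z < X w].
  rewrite (_ : [set w | z < X w] = X @^-1` `]z, +oo[).
    by rewrite -[S in measurable S]setTI; exact: mX.
  by apply/seteqP; split => w /=; rewrite in_itv/= andbT.
have intE z : (\int[P]_w (excess X z w)%:E = (mean_excess P X z)%:E)%E.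
  by rewrite -mean_excessE unlock.
have mE z : measurable_fun setT (fun w => (excess X z w)%:E).
  by apply/measurable_EFinP; exact: measurable_excess.
have intD z : (\int[P]_w (((y - x) * \1_[set w | z < X w] w)%:E + (excess X y
  w)%:E)
    = ((y - x) * F z + mean_excess P X y)%:E)%E.
  rewrite ge0_integralD//.
  - rewrite intE EFinD; congr (_ + _)%E; under eq_integral do rewrite EFinM.
    rewrite ge0_integralZl ?lee_fin ?subr_ge0//.
      by rewrite integral_indic// setIT [RHS]EFinM -FX.
    by apply/measurable_EFinP; exact: measurable_indic.
  - by move=> w _; rewrite lee_fin mulr_ge0 ?subr_ge0.
  - by apply/measurable_EFinP; apply: measurable_funM => //;
      exact: measurable_indic.
  - by move=> w _; rewrite lee_fin excess_ge0.
have mD z : measurable_fun setT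
    (fun w => ((y - x) * \1_[set w | z < X w] w)%:E + (excess X y w)%:E)%E.
  apply: emeasurable_funD => //.
  by apply/measurable_EFinP; apply: measurable_funM => //;
    exact: measurable_indic.
rewrite lerBrDr lerBlDr; apply/andP; split.
- rewrite -lee_fin -intD -intE; apply: ge0_le_integral => //.
  + by move=> w _; rewrite -EFinD lee_fin addr_ge0 ?excess_ge0// mulr_ge0
      ?subr_ge0.
  move=> w _; rewrite -EFinD lee_fin indicE /excess.
  case: (boolP (w \in _)); rewrite ?notin_setE/= ?inE/=.
    by move=> yw; rewrite mulr1 !max_l; lra.
  by move=> _; rewrite mulr0 add0r ge_max !le_max lexx orbT andbT; apply/orP;
    left; lra.
- rewrite -lee_fin -intD -intE; apply: ge0_le_integral => //.
  + by move=> w _; rewrite lee_fin excess_ge0.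
  move=> w _; rewrite -EFinD lee_fin indicE /excess.
  case: (boolP (w \in _)); rewrite ?notin_setE/= ?inE/=.
    move=> xw; rewrite mulr1 ge_max; have : X w - y <= Num.max (X w - y) 0.
      by rewrite le_max lexx.
    have : 0 <= Num.max (X w - y) 0 by rewrite le_max lexx orbT.
    by move=> ? ?; apply/andP; split; lra.
  move=> /negP; rewrite -leNgt => wx.
  by rewrite mulr0 add0r ge_max !le_max lexx orbT andbT; apply/orP; right; lra.
Qed.

End mean_excess_bounds.

Section mean_excess_compare.
Context {R : realType} d (T : measurableType d) (P : probability T R).
Variables (X Y : T -> R) (F H : R -> R) (rate C : R).
Hypothesis mX : measurable_fun setT X.
Hypothesis mY : measurable_fun setT Y.
Hypothesis FX : forall y, P [set w | y < X w] = (F y)%:E.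
Hypothesis HY : forall y, P [set w | y < Y w] = (H y)%:E.
Hypothesis rate_gt0 : 0 < rate.
Hypothesis F_le : forall y, F y <= C * expR (- (rate * y)).
Hypothesis H_le : forall y, H y <= C * expR (- (rate * y)).

(** A tail comparison integrated over the heights above [x]. With [K = 0] it turns stochastic order
    into an order of costs, with [K > 0] it bounds the gap. *)
Lemma mean_excess_le_add (x c K : R) : 0 < c -> 0 <= K ->
  (forall r, 0 <= r -> F (x + r) <= H (x + r) + K * expR (- (c * r))) ->
  mean_excess P X x <= mean_excess P Y x + K / c.
Proof.
move=> c0 K0 FH; rewrite -lee_fin EFinD.
rewrite -(mean_excessE mX FX rate_gt0 F_le) -(mean_excessE mY HY rate_gt0 H_le).
rewrite (expectation_excess _ mX FX) (expectation_excess _ mY HY).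
have H0 y : 0 <= H y by rewrite -lee_fin -HY.
have F0 y : 0 <= F y by rewrite -lee_fin -FX.
have mD (G : R -> R) : measurable_fun setT G ->
    measurable_fun [set: R] (fun r : R => (G (x + r))%:E).
  move=> mG; apply/measurable_EFinP; apply: measurableT_comp => //.
  exact: measurable_funD.
have mF := mD _ (measurable_ccdf mX FX).
have mH := mD _ (measurable_ccdf mY HY).
rewrite -(integral_expRN c0 K0) -ge0_integralD//.
- apply: ge0_le_integral => //.
  + by move=> r _; rewrite lee_fin.
  + exact: (measurable_funTS mF).
  + apply: emeasurable_funD; first exact: (measurable_funTS mH).
    exact: (measurable_funTS (measurable_expRN _ _)).
  + by move=> r; rewrite /= in_itv/= andbT => r0; rewrite -EFinD lee_fin FH.
- by move=> r _; rewrite lee_fin.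
- exact: (measurable_funTS mH).
- by move=> r _; rewrite lee_fin mulr_ge0 ?expR_ge0.
- exact: (measurable_funTS (measurable_expRN _ _)).
Qed.

End mean_excess_compare.

(** * Tails of the maximum of exponentials and of its Gumbel approximation *)

Section tails.
Context {R : realType}.
Implicit Types (rate x u : R) (N : nat).

(** For [N > 0], the tail of [(G + ln N) / rate] with [G] standard Gumbel. *)
Definition gumbel_ccdf rate N x : R := 1 - expR (- (N%:R * expR (- (rate *
  x)))).

Lemma expRN_natl n u : expR (- (n%:R * u)) = expR (- u) ^+ n.
Proof. by rewrite -mulrN mulrC expRM_natr. Qed.

(** By [expR u >= 1 + u] it suffices that [(1 + u) * (1 - u + u ^+ 2) = 1 + u ^+ 3] is at least
    1. *)
Lemma expRN_le_quad u : 0 <= u <= 1 -> expR (- u) <= 1 - u + u ^+ 2.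
Proof.
move=> /andP[u0 u1]; rewrite expRN.
have u3 : 0 <= u ^+ 3 by rewrite exprn_ge0.
have qu : 0 < 1 - u + u ^+ 2 by have := sqr_ge0 (u - 2^-1); rewrite sqrrB; lra.
rewrite -[leRHS]invrK lef_pV2 ?posrE ?invr_gt0 ?expR_gt0//.
apply: le_trans (expR_ge1Dx u); rewrite invf_ple ?posrE//; last lra.
rewrite -[leLHS]mul1r ler_pdivrMr; last lra.
by rewrite (_ : _ * _ = 1 + u ^+ 3) ?lerDl//; ring.
Qed.

Lemma subrXX_le (a b : R) n : 0 <= b <= a ->
  a ^+ n.+1 - b ^+ n.+1 <= n.+1%:R * (a - b) * a ^+ n.
Proof.
move=> /andP[b0 ba]; have a0 := le_trans b0 ba.
elim: n => [|n IH]; first by rewrite !expr1 expr0 mul1r mulr1.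
have -> : a ^+ n.+2 - b ^+ n.+2 =
    (a - b) * a ^+ n.+1 + b * (a ^+ n.+1 - b ^+ n.+1).
  by rewrite !(exprS _ n.+1); ring.
rewrite -[in leRHS]natr1 [leRHS](_ : _ = (a - b) * a ^+ n.+1 +
    a * (n.+1%:R * (a - b) * a ^+ n)); last by rewrite (exprS _ n); ring.
rewrite lerD2l (le_trans (ler_wpM2l b0 IH))// ler_wpM2r//.
by rewrite !mulr_ge0 ?subr_ge0// exprn_ge0.
Qed.

Lemma tail_le1 rate x : 0 < rate -> 0 <= x -> 0 <= expR (- (rate * x)) <= 1.
Proof.
move=> r0 x0; rewrite expR_ge0/= -[leRHS]expR0 ler_expR oppr_le0.
by rewrite mulr_ge0// ltW.
Qed.

(** The union bound. The Gumbel tail has the same majorant, which makes all mean excesses finite. *)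
Lemma max_exp_ccdf_le rate N x : 0 < rate -> (0 < N)%N ->
  max_exp_ccdf rate N x <= N%:R * expR (- (rate * x)).
Proof.
move=> r0 N0; rewrite /max_exp_ccdf; have [x0|x0] := leP 0 x.
  have /andP[u0 u1] := tail_le1 r0 x0; case: N N0 => // n _.
  have := @subrXX_le 1 (1 - expR (- (rate * x))) n.
  rewrite !expr1n mulr1 subKr; apply; apply/andP; split; lra.
rewrite -[leLHS]mulr1 ler_pM// ?ler1n// -[leLHS]expR0 ler_expR oppr_ge0.
by rewrite pmulr_rle0// ltW.
Qed.

Lemma gumbel_ccdf_le rate N x :
  gumbel_ccdf rate N x <= N%:R * expR (- (rate * x)).
Proof.
by rewrite /gumbel_ccdf; have := expR_ge1Dx (- (N%:R * expR (- (rate * x))));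
  lra.
Qed.

Lemma gumbel_le_max_exp rate N x : 0 < rate ->
  gumbel_ccdf rate N x <= max_exp_ccdf rate N x.
Proof.
move=> r0; rewrite /gumbel_ccdf /max_exp_ccdf; have [x0|x0] := leP 0 x;
  last first.
  by have := expR_ge0 (- (N%:R * expR (- (rate * x)))); lra.
have /andP[u0 u1] := tail_le1 r0 x0.
rewrite lerD2l lerN2 expRN_natl lerXn2r ?nnegrE ?expR_ge0//.
  by rewrite subr_ge0.
by have := expR_ge1Dx (- expR (- (rate * x))); lra.
Qed.

(** A difference of powers of [expR (- u)] and [1 - u], two bases at distance at most [u ^+ 2]. *)
Lemma max_exp_sub_gumbel rate n x (u := expR (- (rate * x))) :
  0 < rate -> 0 <= x ->
  max_exp_ccdf rate n.+1 x - gumbel_ccdf rate n.+1 x <=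
  n.+1%:R * u ^+ 2 * expR (- (n%:R * u)).
Proof.
move=> r0 x0; have u01 : 0 <= u <= 1 by exact: tail_le1.
have /andP[u0 u1] := u01.
rewrite /max_exp_ccdf x0 /gumbel_ccdf -/u.
rewrite !expRN_natl.
have ab : 0 <= 1 - u <= expR (- u).
  by have := expR_ge1Dx (- u); rewrite subr_ge0 u1.
have -> : 1 - (1 - u) ^+ n.+1 - (1 - expR (- u) ^+ n.+1) =
  expR (- u) ^+ n.+1 - (1 - u) ^+ n.+1 by ring.
apply: le_trans (subrXX_le n ab) _.
rewrite ler_wpM2r ?exprn_ge0 ?expR_ge0// ler_wpM2l//.
by have := expRN_le_quad u01; lra.
Qed.

(** With [v = (N - 1) u], the bound [v exp (- v) <= 1] absorbs the factor [N], and
    [N / (N - 1) <= 2] gives the constant. The result is uniform in [N], for levels where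
    [N * u ^+ 2] is not small. *)
Lemma max_exp_sub_gumbel_lin rate N x (u := expR (- (rate * x))) :
  0 < rate -> 0 <= x -> (2 <= N)%N ->
  max_exp_ccdf rate N x - gumbel_ccdf rate N x <= 2 * u.
Proof.
move=> r0 x0; case: N => [//|[//|n]] _.
apply: le_trans (max_exp_sub_gumbel n.+1 r0 x0) _; rewrite -/u.
have u0 : 0 <= u by exact: expR_ge0.
have nu : n.+1%:R * u * expR (- (n.+1%:R * u)) <= 1.
  set v := n.+1%:R * u; have v0 : 0 <= v by rewrite mulr_ge0.
  rewrite expRN ler_pdivrMr ?expR_gt0// mul1r.
  by have := expR_ge1Dx v; lra.
have -> : n.+2%:R * u ^+ 2 * expR (- (n.+1%:R * u)) =
    (n.+2%:R / n.+1%:R) * (n.+1%:R * u * expR (- (n.+1%:R * u))) * u.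
  by rewrite -[n.+1%:R * u * _]mulrA [_ * (n.+1%:R * _)]mulrA divfK
    ?pnatr_eq0//; ring.
rewrite ler_wpM2r//; rewrite -[leRHS]mulr1 ler_pM//.
- by rewrite !mulr_ge0 ?expR_ge0.
- by rewrite ler_pdivrMr ?ltr0n// -natrM ler_nat mulSn mul1n addSn addnS !ltnS
    leq_addr.
Qed.

Lemma max_exp_sub_gumbel_quad rate N x (u := expR (- (rate * x))) :
  0 < rate -> 0 <= x -> (0 < N)%N ->
  max_exp_ccdf rate N x - gumbel_ccdf rate N x <= N%:R * u ^+ 2.
Proof.
move=> r0 x0; case: N => [//|n] _.
apply: le_trans (max_exp_sub_gumbel n r0 x0) _; rewrite -/u.
rewrite ler_piMr ?mulr_ge0 ?exprn_ge0 ?expR_ge0//.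
by rewrite -[leRHS]expR0 ler_expR oppr_le0 mulr_ge0// expR_ge0.
Qed.

Lemma gumbel_ccdf_lt rate N x y : 0 < rate -> (0 < N)%N -> x < y ->
  gumbel_ccdf rate N y < gumbel_ccdf rate N x.
Proof.
move=> r0 N0 xy; rewrite /gumbel_ccdf ltrD2l ltrN2 ltr_expR ltrN2.
by rewrite ltr_pM2l ?ltr0n// ltr_expR ltrN2 ltr_pM2l.
Qed.

Lemma gumbel_ccdf_quantile rate N (g : R) : 0 < rate -> (0 < N)%N -> 0 < g < 1
    ->
  gumbel_ccdf rate N (ln (N%:R / - ln (1 - g)) / rate) = g.
Proof.
move=> r0 N0 /andP[g0 g1]; rewrite /gumbel_ccdf.
have k0 : 0 < - ln (1 - g) by rewrite oppr_gt0 ln_lt0//; apply/andP; split; lra.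
rewrite [rate * _]mulrC divfK ?gt_eqF// [expR (- ln _)]expRN lnK ?posrE
  ?divr_gt0 ?ltr0n//.
rewrite invf_div [_%:R * _]mulrC divfK ?pnatr_eq0 -?lt0n// opprK lnK ?posrE//;
  lra.
Qed.

End tails.

(** * Costs and minimizers *)

Section optimisation.
Context {R : realType}.

Lemma minimizer_location (C : R -> R) (n : R) (F : R -> R -> \bar R) (z : R *
    R) :
  (forall x y, F x y = (y^-1 * C x + y * n)%:E) ->
  is_minimizer F z -> forall x, C z.1 <= C x.
Proof.
move=> FE [z0 zmin] x; have := zmin x z.2 z0.
by rewrite !FE lee_fin lerD2r ler_pM2l// invr_gt0.
Qed.

(** With [C = n * s ^+ 2], the value at scale [y] exceeds the value at [s] by exactly
    [n * (y - s) ^+ 2 / y]. *)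
Lemma minimizer_scale (C : R -> R) (n : R) (F : R -> R -> \bar R) (z : R * R) :
  0 < n -> (forall x y, F x y = (y^-1 * C x + y * n)%:E) ->
  is_minimizer F z -> 0 < C z.1 -> z.2 = Num.sqrt (C z.1 / n).
Proof.
move=> n0 FE [z0 zmin] C0; set s := Num.sqrt _.
have s0 : 0 < s by rewrite sqrtr_gt0 divr_gt0.
have Cs : C z.1 = n * s ^+ 2 by rewrite sqr_sqrtr ?divr_ge0 ?ltW// mulrC divfK
  ?gt_eqF.
have := zmin z.1 s s0; rewrite !FE lee_fin Cs => H.
have {}H : (z.2 - s) ^+ 2 <= 0.
  rewrite -(pmulr_rle0 _ n0) -(pmulr_lle0 _ (_ : 0 < z.2^-1)) ?invr_gt0//.
  have -> : n * (z.2 - s) ^+ 2 * z.2^-1 =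
      z.2^-1 * (n * s ^+ 2) + z.2 * n - (s^-1 * (n * s ^+ 2) + s * n).
    by field; rewrite !gt_eqF.
  by rewrite subr_le0.
apply/eqP; rewrite -subr_eq0 -sqrf_eq0 eq_le H; exact: sqr_ge0.
Qed.

(** Here [n * s ^+ 2] and [n * t ^+ 2] are the minimal exact and approximate costs, and [c] is the
    exact cost at the approximate level. The gap is [(c + n t^2 - 2 n s t) / (c + n t^2)]: its
    numerator is nonnegative by the arithmetic-geometric inequality and at most [c - n t^2] because
    [t <= s]. *)
Lemma relative_gap_le (n s t c : R) : 0 < n -> 0 < t -> t <= s -> n * s ^+ 2 <=
    c ->
  `|1 - (s^-1 * (n * s ^+ 2) + s * n) / (t^-1 * c + t * n)| <=
  (c - n * t ^+ 2) / (n * t ^+ 2).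
Proof.
move=> n0 t0 ts sc; have s0 := lt_le_trans t0 ts.
have c0 : 0 < c by apply: lt_le_trans sc; rewrite mulr_gt0// exprn_gt0.
have nt0 : 0 < n * t ^+ 2 by rewrite mulr_gt0// exprn_gt0.
have cnt0 : 0 < c + n * t ^+ 2 by rewrite addr_gt0.
have nst : n * t ^+ 2 <= n * s * t.
  by rewrite expr2 mulrA ler_pM2r// ler_pM2l.
have amgm : 2 * (n * s * t) <= n * s ^+ 2 + n * t ^+ 2.
  have : 0 <= n * (s - t) ^+ 2 by rewrite mulr_ge0 ?sqr_ge0// ltW.
  have -> : n * (s - t) ^+ 2 = n * s ^+ 2 + n * t ^+ 2 - 2 * (n * s * t) by
    ring.
  lra.
have -> : 1 - (s^-1 * (n * s ^+ 2) + s * n) / (t^-1 * c + t * n) =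
    (c + n * t ^+ 2 - 2 * (n * s * t)) / (c + n * t ^+ 2).
  field; rewrite !gt_eqF//= -?expr2; move: cnt0; lra.
rewrite ger0_norm; last by rewrite divr_ge0 ?(ltW cnt0)//; lra.
rewrite ler_pM ?invr_ge0 ?(ltW cnt0)//; [lra|lra|].
by rewrite lef_pV2 ?posrE//; lra.
Qed.

End optimisation.

Section affine_cost.
Context d (T : measurableType d) (R : realType) (P : probability T R).

Lemma expectation_affine (X Y : T -> R) (a c x : R) :
  P.-integrable setT (EFin \o X) -> P.-integrable setT (EFin \o Y) ->
  'E_P[fun w => (a * (x - X w) + c * Y w)%R]%E =
  (a * (x - fine 'E_P[X]%E) + c * fine 'E_P[Y]%E)%:E.
Proof.
move=> iX iY; rewrite !unlock.
have fX : (\int[P]_w (X w)%:E)%E \is a fin_num by exact: integrable_fin_num.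
have fY : (\int[P]_w (Y w)%:E)%E \is a fin_num by exact: integrable_fin_num.
have ix : P.-integrable setT (EFin \o cst x) by exact:
  finite_measure_integrable_cst.
have iaX : P.-integrable setT (fun w => a%:E * (x%:E - (X w)%:E))%E.
  by apply: integrableZl => //; exact: integrableB.
have icY : P.-integrable setT (fun w => c%:E * (Y w)%:E)%E by exact:
  integrableZl.
transitivity (\int[P]_w (a%:E * (x%:E - (X w)%:E) + c%:E * (Y w)%:E))%E.
  by apply: eq_integral => w _.
rewrite integralD// integralZl//; last exact: integrableB.
rewrite integralB// integralZl// integral_cst//= probability_setT mule1.
by rewrite EFinD !EFinM EFinB !fineK.
Qed.

End affine_cost.

Section gumbel.
Context d (T : measurableType d) (R : realType) (P : probability T R).
Variables (sigma : R) (G : {RV P >-> R}).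
Hypothesis sigma_gt0 : 0 < sigma.
Hypothesis G_gumbel : standard_gumbel G.

Local Notation th := (2 / sigma ^+ 2).

Definition scaled_gumbel (N : nat) (w : T) : R :=
  sigma ^+ 2 / 2 * G w + sigma ^+ 2 / 2 * ln N%:R.

Lemma measurable_scaled_gumbel N : measurable_fun setT (scaled_gumbel N).
Proof. by apply: measurable_funD => //; exact: measurable_funM. Qed.

Lemma scaled_gumbel_ccdf N (x : R) : (0 < N)%N ->
  P [set w | x < scaled_gumbel N w] = (gumbel_ccdf th N x)%:E.
Proof.
move=> N0; have th0 := exp_rate_gt0 sigma_gt0.
have -> : [set w | x < scaled_gumbel N w] = [set w | th * x - ln N%:R < G w].
  apply/funext => w; apply/propext; rewrite /= ltrBlDr -[x < _](ltr_pM2l th0).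
  suff -> : th * scaled_gumbel N w = G w + ln N%:R by [].
  by rewrite /scaled_gumbel; field; rewrite gt_eqF.
have := ccdf_1_cdf G (th * x - ln N%:R); rewrite G_gumbel.
rewrite /ccdf /distribution /pushforward => H.
transitivity (P (G @^-1` `]th * x - ln N%:R, +oo[)).
  by congr (P _); apply/seteqP; split => w /=; rewrite in_itv/= andbT.
rewrite H -EFinB /gumbel_ccdf; congr (1 - expR (- _))%:E.
by rewrite opprB expRD lnK ?posrE ?ltr0n.
Qed.

End gumbel.

Section costs.
Context d (T : measurableType d) (R : realType) (P : probability T R).
Variables (sigma : R) (W : nat -> R -> {RV P >-> R}) (G : {RV P >-> R}).
Variables (h b : nat -> R).
Hypothesis sigma_gt0 : 0 < sigma.
Hypothesis W_bm : forall i, brownian_motion sigma (W i).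
Hypothesis W_indep : independent_processes P (fun i t => W i t : T -> R).
Hypothesis G_gumbel : standard_gumbel G.

Local Notation th := (2 / sigma ^+ 2).
Local Notation Q0 := (sup_drifted (fun t => W 0%N t : T -> R)).
Local Notation M N := (max_sup (fun i t => W i t : T -> R) N).
Local Notation gam N := (gamma_ratio h b N).

Let th0 : 0 < th. Proof. exact: exp_rate_gt0. Qed.

Lemma max_sup1 : M 1 = Q0.
Proof.
apply/funext => w; apply/eqP; rewrite eq_le; apply/andP; split.
  by apply/(@max_supP _ _ _ _ W) => // -[].
exact: (@max_supP _ _ _ _ W 1 w _ isT).1 (lexx _) 0%N isT.
Qed.

Lemma integrable_max_sup_excess N x : (0 < N)%N ->
  P.-integrable setT (EFin \o excess (M N) x).
Proof.
move=> N0; apply: (integrable_excess (measurable_max_sup W_bm N)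
  (fun y => max_sup_ccdf sigma_gt0 W_bm W_indep y N0) th0).
by move=> y; exact: max_exp_ccdf_le.
Qed.

Lemma integrable_gumbel_excess N x : (0 < N)%N ->
  P.-integrable setT (EFin \o excess (scaled_gumbel sigma G N) x).
Proof.
move=> N0; apply: (integrable_excess (measurable_scaled_gumbel _ _ _)
  (fun y => scaled_gumbel_ccdf sigma_gt0 G_gumbel y N0) th0).
by move=> y; exact: gumbel_ccdf_le.
Qed.

(** The supremum is almost surely positive, so its absolute value is the excess over 0 of a maximum
    of one term, already known to be integrable. *)
Lemma integrable_sup_drifted : P.-integrable setT (EFin \o Q0).
Proof.
have mQ := measurable_sup_drifted_bm W_bm 0%N.
have mset : measurable [set w | 0 < Q0 w].
  rewrite (_ : [set w | 0 < Q0 w] = Q0 @^-1` `]0, +oo[).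
    by rewrite -[X in measurable X]setTI; exact: mQ.
  by apply/seteqP; split => w /=; rewrite in_itv/= andbT.
have Qpos : {ae P, forall w, 0 < Q0 w}.
  exists (~` [set w | 0 < Q0 w]); split => //; first exact: measurableC.
  rewrite probability_setC// (sup_drifted_ccdf sigma_gt0 (W_bm 0%N))//.
  by rewrite mulr0 oppr0 expR0 subee.
have /integrableP[mE iE] := integrable_max_sup_excess 0 (ltnSn 0).
apply/integrableP; split; first exact/measurable_EFinP.
apply: le_lt_trans iE; rewrite le_eqVlt; apply/orP; left; apply/eqP.
apply: ae_eq_integral => //.
- by apply: measurableT_comp => //; exact/measurable_EFinP.
- exact: measurableT_comp.
- apply: filterS Qpos => w Qw _ /=; rewrite max_sup1 /excess subr0 max_l//.
  exact: ltW.
Qed.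

Definition mean_sup : R := fine 'E_P[Q0]%E.

(* The costs divided by [N h N + b N]. *)
Definition unit_cost N x : R := gam N * (x - mean_sup) + mean_excess P (M N) x.

Definition unit_approx_cost N x : R :=
  gam N * (x - mean_sup) + mean_excess P (scaled_gumbel sigma G N) x.

Let weight N : R := N%:R * h N + b N.

Let weight_gamma N : 0 < weight N -> weight N * gam N = N%:R * h N.
Proof. by move=> w0; rewrite /gamma_ratio mulrC divfK// gt_eqF. Qed.

Lemma F_costE N x y : (0 < N)%N -> 0 < weight N ->
  F_cost P W h b N x y = (y^-1 * (weight N * unit_cost N x) + y * N%:R)%:E.
Proof.
move=> N0 w0; rewrite /F_cost /total_cost /cost.
rewrite (expectation_affine (Y := excess (M N) x) (N%:R * h N) (N%:R * h N + b
  N) x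
  integrable_sup_drifted); last exact: integrable_max_sup_excess.
rewrite -EFinM -EFinD; congr (_ * _ + _)%:E.
by rewrite /unit_cost [RHS]mulrDr [weight N * (_ * _)]mulrA weight_gamma.
Qed.

Lemma F_approxE N x y : (0 < N)%N -> 0 < weight N ->
  F_approx P sigma W G h b N x y =
  (y^-1 * (weight N * unit_approx_cost N x) + y * N%:R)%:E.
Proof.
move=> N0 w0; rewrite /F_approx /total_cost /approx_cost.
rewrite (expectation_affine (Y := excess (scaled_gumbel sigma G N) x) (N%:R * h
  N)
  (N%:R * h N + b N) x integrable_sup_drifted);
    last exact: integrable_gumbel_excess.
rewrite -EFinM -EFinD; congr (_ * _ + _)%:E.
by rewrite /unit_approx_cost [RHS]mulrDr [weight N * (_ * _)]mulrA weight_gamma.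
Qed.

Lemma unit_approx_cost_le N x : (0 < N)%N ->
  unit_approx_cost N x <= unit_cost N x.
Proof.
move=> N0; rewrite lerD2l -[leRHS]addr0 -(mul0r 1^-1).
apply: (mean_excess_le_add (measurable_scaled_gumbel _ _ _) (measurable_max_sup
  W_bm N)
  (fun y => scaled_gumbel_ccdf sigma_gt0 G_gumbel y N0)
  (fun y => max_sup_ccdf sigma_gt0 W_bm W_indep y N0) th0 (gumbel_ccdf_le th
    N)) => //.
  by move=> y; exact: max_exp_ccdf_le.
by move=> r _; rewrite mul0r addr0; exact: gumbel_le_max_exp.
Qed.

Lemma unit_cost_gap_le N x (c K : R) : (0 < N)%N -> 0 < c -> 0 <= K ->
  (forall r, 0 <= r -> max_exp_ccdf th N (x + r) - gumbel_ccdf th N (x + r) <=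
     K * expR (- (c * r))) ->
  unit_cost N x - unit_approx_cost N x <= K / c.
Proof.
move=> N0 c0 K0 H; rewrite lerBlDl -addrA lerD2l.
apply: (mean_excess_le_add (measurable_max_sup W_bm N)
  (measurable_scaled_gumbel _ _ _)
  (fun y => max_sup_ccdf sigma_gt0 W_bm W_indep y N0)
  (fun y => scaled_gumbel_ccdf sigma_gt0 G_gumbel y N0) th0 _ (gumbel_ccdf_le
    th N)) => //.
  by move=> y; exact: max_exp_ccdf_le.
by move=> r r0; rewrite -lerBlDl; exact: H.
Qed.

Lemma unit_cost_gap_lin N x : (2 <= N)%N -> 0 <= x ->
  unit_cost N x - unit_approx_cost N x <= 2 / th.
Proof.
move=> N2 x0; have N0 : (0 < N)%N by exact: ltnW.
apply: unit_cost_gap_le => // r r0; have xr0 : 0 <= x + r by exact: addr_ge0.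
apply: le_trans (max_exp_sub_gumbel_lin th0 xr0 N2) _.
by rewrite ler_wpM2l// ler_expR lerN2 ler_pM2l// lerDr.
Qed.

Lemma unit_cost_gap_quad N x : (0 < N)%N -> 0 <= x ->
  unit_cost N x - unit_approx_cost N x <=
  N%:R * expR (- (th * x)) ^+ 2 / (2 * th).
Proof.
move=> N0 x0; apply: unit_cost_gap_le => //; first by rewrite mulr_gt0.
move=> r r0; have xr0 : 0 <= x + r by exact: addr_ge0.
apply: le_trans (max_exp_sub_gumbel_quad th0 xr0 N0) _.
rewrite mulrDr opprD expRD exprMn -mulrA ler_wpM2l// ler_wpM2l ?exprn_ge0
  ?expR_ge0//.
by rewrite -expRM_natl mulrN -[2 * th * r]mulrA.
Qed.

End costs.

(** * Relative gap in the three regimes *)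

Section relative_gap.
Context d (T : measurableType d) (R : realType) (P : probability T R).
Variables (sigma : R) (W : nat -> R -> {RV P >-> R}) (G : {RV P >-> R}).
Variables (h b : nat -> R) (opt opt_hat : nat -> R * R).
Hypothesis sigma_gt0 : 0 < sigma.
Hypothesis W_bm : forall i, brownian_motion sigma (W i).
Hypothesis W_indep : independent_processes P (fun i t => W i t : T -> R).
Hypothesis G_gumbel : standard_gumbel G.
Hypothesis h_gt0 : forall N, (2 <= N)%N -> 0 < h N.
Hypothesis b_gt0 : forall N, (2 <= N)%N -> 0 < b N.
Hypothesis opt_min : forall N, (2 <= N)%N ->
  is_minimizer (F_cost P W h b N) (opt N).
Hypothesis opt_hat_min : forall N, (2 <= N)%N ->
  is_minimizer (F_approx P sigma W G h b N) (opt_hat N).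

Local Notation th := (2 / sigma ^+ 2).
Local Notation gam N := (gamma_ratio h b N).
Local Notation ratio := (cost_ratio (F_cost P W h b) opt opt_hat).
Local Notation m := (mean_sup W).
Local Notation u_cost := (unit_cost W h b).
Local Notation u_approx := (unit_approx_cost sigma W G h b).

Let th0 : 0 < th. Proof. exact: exp_rate_gt0. Qed.

Let weight_gt0 N : (2 <= N)%N -> 0 < N%:R * h N + b N.
Proof.
by move=> N2; rewrite addr_gt0 ?b_gt0// mulr_gt0 ?h_gt0// ltr0n ltnW.
Qed.

Lemma gamma_ratio_itv N : (2 <= N)%N -> 0 < gam N < 1.
Proof.
move=> N2; have N0 : 0 < N%:R :> R by rewrite ltr0n ltnW.
have hN := h_gt0 N2; have bN := b_gt0 N2.
have hw : 0 < N%:R * h N by rewrite mulr_gt0.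
by rewrite divr_gt0 ?weight_gt0// ltr_pdivrMr ?weight_gt0// mul1r ltrDl.
Qed.

(** The solution of [1 - expR (- kappa) = gam]: the expected number of exceedances at which the
    Gumbel tail equals [gam]. *)
Definition kappa N : R := - ln (1 - gam N).

Lemma kappa_gt0 N : (2 <= N)%N -> 0 < kappa N.
Proof.
move=> N2; have /andP[g0 g1] := gamma_ratio_itv N2.
by rewrite oppr_gt0 ln_lt0// subr_gt0 g1 gtrBl.
Qed.

Definition approx_level N : R := ln (N%:R / kappa N) / th.

Lemma approx_level_tail N : (2 <= N)%N ->
  expR (- (th * approx_level N)) = kappa N / N%:R.
Proof.
move=> N2; have k0 := kappa_gt0 N2.
have N0 : 0 < N%:R :> R by rewrite ltr0n ltnW.
rewrite /approx_level [th * _]mulrC divfK ?gt_eqF// expRN lnK ?posrE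
  ?divr_gt0//.
by rewrite invf_div.
Qed.

Lemma approx_level_ge0 N : (2 <= N)%N -> kappa N <= N%:R -> 0 <= approx_level N.
Proof.
move=> N2 kN; rewrite divr_ge0 ?(ltW th0)// ln_ge0//.
by rewrite ler_pdivlMr ?kappa_gt0// mul1r.
Qed.

Let diff N x y : (0 < N)%N -> x <= y ->
  (y - x) * gumbel_ccdf th N y <=
    mean_excess P (scaled_gumbel sigma G N) x -
    mean_excess P (scaled_gumbel sigma G N) y <= (y - x) * gumbel_ccdf th N x.
Proof.
move=> N0; exact: (mean_excess_diff (measurable_scaled_gumbel _ _ _)
  (fun y => scaled_gumbel_ccdf sigma_gt0 G_gumbel y N0) th0 (gumbel_ccdf_le th
    N)).
Qed.

(* [u_approx N] has slope [gam N - gumbel_ccdf th N x] at [x]. *)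
Lemma approx_minimizer N x : (2 <= N)%N ->
  (forall y, u_approx N x <= u_approx N y) -> x = approx_level N.
Proof.
move=> N2 xmin; have N0 : (0 < N)%N by exact: ltnW.
have qg : gumbel_ccdf th N (approx_level N) = gam N.
  by apply: gumbel_ccdf_quantile => //; exact: gamma_ratio_itv.
(* The competitor is the midpoint: there the tail differs strictly from [gam N], so the cost drops
   strictly, whereas comparing with the quantile itself would give only a weak inequality. *)
have := xmin ((x + approx_level N) / 2); rewrite /unit_approx_cost.
set q := approx_level N in qg *; set y := (x + q) / 2 => xy.
have [xq|qx|//] := ltgtP x q; exfalso.
- have [/(diff N0)/andP[+ _] yq] : x <= y /\ y < q by rewrite /y; split; lra.
  have := gumbel_ccdf_lt th0 N0 yq; rewrite qg => gy e.
  have : (y - x) * gam N < (y - x) * gumbel_ccdf th N y.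
    by rewrite ltr_pM2l// /y; lra.
  have -> : (y - x) * gam N = gam N * (y - m) - gam N * (x - m) by ring.
  lra.
- have [/(diff N0)/andP[_ +] qy] : y <= x /\ q < y by rewrite /y; split; lra.
  have := gumbel_ccdf_lt th0 N0 qy; rewrite qg => gy e.
  have : (x - y) * gumbel_ccdf th N y < (x - y) * gam N.
    by rewrite ltr_pM2l// /y; lra.
  have -> : (x - y) * gam N = gam N * (x - m) - gam N * (y - m) by ring.
  lra.
Qed.

Lemma opt_hat_level N : (2 <= N)%N -> (opt_hat N).1 = approx_level N.
Proof.
move=> N2; have N0 : (0 < N)%N by exact: ltnW.
have w0 := weight_gt0 N2; apply: approx_minimizer => // y.
have FA x z := F_approxE (b := b) sigma_gt0 W_bm W_indep G_gumbel x z N0 w0.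
by rewrite -(ler_pM2l w0); exact: minimizer_location FA (opt_hat_min N2) y.
Qed.

Lemma ratio_gap N (q := approx_level N) : (2 <= N)%N -> 0 < u_approx N q ->
  `|1 - ratio N| <= (u_cost N q - u_approx N q) / u_approx N q.
Proof.
move=> N2 uq; have N0 : (0 < N)%N by exact: ltnW.
have NR0 : 0 < N%:R :> R by rewrite ltr0n.
have w0 := weight_gt0 N2.
have FC x y := F_costE (b := b) sigma_gt0 W_bm W_indep x y N0 w0.
have FA x y := F_approxE (b := b) sigma_gt0 W_bm W_indep G_gumbel x y N0 w0.
set w := N%:R * h N + b N in w0 FC FA.
have hat1 : (opt_hat N).1 = q by exact: opt_hat_level.
have minC := minimizer_location FC (opt_min N2).
have minA := minimizer_location FA (opt_hat_min N2).
rewrite hat1 in minA.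
have ua_le x : w * u_approx N q <= w * u_cost N x.
  apply: le_trans (minA x) _; rewrite ler_pM2l//.
  exact: unit_approx_cost_le.
have wuq : 0 < w * u_approx N q by rewrite mulr_gt0.
have wuc : 0 < w * u_cost N (opt N).1 by apply: lt_le_trans (ua_le _).
have hat2 := minimizer_scale NR0 FA (opt_hat_min N2).
rewrite hat1 in hat2; have {}hat2 := hat2 wuq.
have opt2 := minimizer_scale NR0 FC (opt_min N2) wuc.
rewrite /cost_ratio !FC /= hat1 hat2 opt2.
set s := Num.sqrt _; set t := Num.sqrt (w * u_approx N q / _).
have sE : w * u_cost N (opt N).1 = N%:R * s ^+ 2.
  by rewrite sqr_sqrtr ?divr_ge0 ?ltW// [RHS]mulrC divfK ?gt_eqF.
have tE : w * u_approx N q = N%:R * t ^+ 2.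
  by rewrite sqr_sqrtr ?divr_ge0 ?ltW// [RHS]mulrC divfK ?gt_eqF.
have t0 : 0 < t by rewrite sqrtr_gt0 divr_gt0.
have ts : t <= s by rewrite ler_wsqrtr// ler_pM2r ?invr_gt0.
have sc : N%:R * s ^+ 2 <= w * u_cost N q by rewrite -sE.
rewrite sE; apply: le_trans (relative_gap_le NR0 t0 ts sc) _.
by rewrite -tE -mulrBr -mulf_div divff ?gt_eqF// mul1r.
Qed.

(* [a / th] is the distance from [mean_sup W] to the optimal level. *)
Lemma ratio_gap_quad N (a := ln (N%:R / kappa N) - th * m) :
  (2 <= N)%N -> kappa N <= N%:R -> 0 < a ->
  `|1 - ratio N| <= kappa N ^+ 2 / (2 * N%:R * gam N * a).
Proof.
move=> N2 kN a0; have N0 : (0 < N)%N by exact: ltnW.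
have NR0 : 0 < N%:R :> R by rewrite ltr0n.
have /andP[g0 g1] := gamma_ratio_itv N2; have k0 := kappa_gt0 N2.
have q0 := approx_level_ge0 N2 kN; set q := approx_level N in q0.
have qa : q - m = a / th.
  by rewrite /q /approx_level /a [RHS]mulrBl [th * m]mulrC mulfK ?gt_eqF.
(* The mean excess is discarded; the linear part alone has the right order here. *)
have ua : gam N * (a / th) <= u_approx N q.
  by rewrite /unit_approx_cost qa lerDl mean_excess_ge0.
have ga0 : 0 < gam N * (a / th) by rewrite mulr_gt0// divr_gt0.
have ua0 := lt_le_trans ga0 ua.
apply: le_trans (ratio_gap N2 ua0) _.
have := unit_cost_gap_quad h b sigma_gt0 W_bm W_indep G_gumbel N0 q0.
rewrite approx_level_tail// => gap.
apply: (@le_trans _ _ (N%:R * (kappa N / N%:R) ^+ 2 / (2 * th) / (gam N * (a /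
  th)))).
  rewrite ler_pM ?invr_ge0 ?(ltW ua0)//.
    by rewrite subr_ge0; exact: unit_approx_cost_le.
  by rewrite lef_pV2 ?posrE.
rewrite le_eqVlt; apply/orP; left; apply/eqP.
by field; rewrite ?gt_eqF// ?exprn_gt0.
Qed.

(** The level [q] may lie anywhere between 0 and [ln N / th]. The linear part contributes at least
    [q / 2] up to the mean, and the mean excess at least half of the remaining distance, so the cost
    is of order [ln N] wherever [q] is. The lower bound on [gam N] gives [kappa N >= 1], hence the
    upper end of this range. *)
Lemma ratio_gap_lin N (a := ln N%:R / 2 - th * `|m|) : (2 <= N)%N ->
  1 - expR (-1) <= gam N -> kappa N <= N%:R -> 0 < a ->
  `|1 - ratio N| <= 2 / a.
Proof.
move=> N2 gN kN a0; have N0 : (0 < N)%N by exact: ltnW.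
have NR0 : 0 < N%:R :> R by rewrite ltr0n.
have /andP[g0 g1] := gamma_ratio_itv N2; have k0 := kappa_gt0 N2.
have q0 := approx_level_ge0 N2 kN; set q := approx_level N in q0.
have e2 : expR (-1) <= 2^-1 :> R.
  rewrite expRN lef_pV2 ?posrE ?expR_gt0//.
  by have := expR_ge1Dx (1 : R); lra.
have k1 : 1 <= kappa N.
  rewrite /kappa lerNr -ler_expR lnK ?posrE ?subr_gt0//.
  by rewrite lerBlDr -lerBlDl.
(* At this level [N u = 1], so the Gumbel tail is exactly [1 - expR (-1)], which is at least one
   half. *)
pose J := ln N%:R / th.
have qJ : q <= J.
  rewrite /q /J /approx_level ler_pM2r ?invr_gt0// ler_ln ?posrE ?divr_gt0//.
  by rewrite ler_pdivrMr// ler_peMr// ltW.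
have phiJ : gumbel_ccdf th N J = 1 - expR (-1).
  rewrite /gumbel_ccdf /J [th * _]mulrC divfK ?gt_eqF// [expR (- ln _)]expRN.
  by rewrite lnK ?posrE// divff ?gt_eqF.
have ua : a / th <= u_approx N q.
  have /andP[H _] := diff N0 qJ; rewrite phiJ in H.
  have eJ : 0 <= mean_excess P (scaled_gumbel sigma G N) J by exact:
    mean_excess_ge0.
  have h1 : (J - q) * 2^-1 <= (J - q) * (1 - expR (-1)).
    by rewrite ler_wpM2l ?subr_ge0//; lra.
  have h2 : q * 2^-1 <= q * gam N by rewrite ler_wpM2l//; lra.
  have h3 : gam N * m <= `|m|.
    apply: le_trans (ler_norm _) _; rewrite normrM (gtr0_norm g0).
    by rewrite ler_piMl// ltW.
  have -> : a / th = J * 2^-1 - `|m|.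
    rewrite /a /J [LHS]mulrBl [th * `|m|]mulrC mulfK ?gt_eqF//.
    by rewrite mulrAC.
  by rewrite /unit_approx_cost mulrBr [gam N * q]mulrC; lra.
have ath0 : 0 < a / th by rewrite divr_gt0.
have ua0 := lt_le_trans ath0 ua.
apply: le_trans (ratio_gap N2 ua0) _.
have gap := unit_cost_gap_lin h b sigma_gt0 W_bm W_indep G_gumbel N2 q0.
apply: (@le_trans _ _ (2 / th / (a / th))).
  rewrite ler_pM ?invr_ge0 ?(ltW ua0)//.
    by rewrite subr_ge0; exact: unit_approx_cost_le.
  by rewrite lef_pV2 ?posrE.
by rewrite [(a / th)^-1]invf_div [leLHS]mulrA divfK ?gt_eqF.
Qed.

Lemma near_ln_ge (A : R) : \forall N \near \oo, A <= ln (N%:R : R).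
Proof.
near=> N; have : expR A <= N%:R by near: N; exact: nbhs_infty_ger.
by move=> AN; rewrite -ler_expR lnK// posrE (lt_le_trans (expR_gt0 A)).
Unshelve. all: by end_near. Qed.

Lemma ratio_balanced (g : R) : 0 < g < 1 ->
  (forall N, (2 <= N)%N -> gam N = g) ->
  (fun N => 1 - ratio N) =O_\oo (fun N => (N%:R * ln N%:R)^-1).
Proof.
move=> /andP[g0 g1] gE; pose k := - ln (1 - g).
have kE N : (2 <= N)%N -> kappa N = k by move=> N2; rewrite /kappa gE.
have k0 : 0 < k by rewrite oppr_gt0 ln_lt0// subr_gt0 g1 gtrBl.
(* For large [N] half of [ln N] absorbs [ln k + th * m]; the other half cancels the factor 2 in the
   denominator of [ratio_gap_quad]. *)
apply/eqO_exP; exists (k ^+ 2 / g); first by rewrite divr_gt0// exprn_gt0.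
near=> N.
have N2 : (2 <= N)%N by near: N; exact: nbhs_infty_ge.
have kN : k <= N%:R by near: N; exact: nbhs_infty_ger.
have LN : 2 * (ln k + th * m) <= ln (N%:R : R) by near: N; exact: near_ln_ge.
have LN1 : 1 <= ln (N%:R : R) by near: N; exact: near_ln_ge.
have NR0 : 0 < N%:R :> R by rewrite ltr0n ltnW.
have aE : ln (N%:R / kappa N) - th * m = ln N%:R - ln k - th * m.
  by rewrite kE// ln_div ?posrE.
have La : ln N%:R / 2 <= ln (N%:R / kappa N) - th * m by rewrite aE; lra.
have a0 : 0 < ln (N%:R / kappa N) - th * m by apply: lt_le_trans La; lra.
have L0 : 0 < ln (N%:R : R) by lra.
have kN' : kappa N <= N%:R by rewrite kE.
apply: le_trans (ratio_gap_quad N2 kN' a0) _.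
rewrite gE// kE// in a0 La *.
rewrite ger0_norm ?invr_ge0 ?mulr_ge0 ?(ltW L0)//.
rewrite -[leRHS]mulrA -invfM ler_wpM2l ?exprn_ge0 ?(ltW k0)//.
rewrite lef_pV2 ?posrE ?mulr_gt0//.
have -> : g * (N%:R * ln N%:R) = 2 * N%:R * g * (ln N%:R / 2) by field.
by rewrite ler_pM2l// !mulr_gt0.
Unshelve. all: by end_near. Qed.

Lemma ratio_quality : (fun N => gam N) @ \oo --> (0 : R) ->
  (fun N => 1 - ratio N) =O_\oo
    (fun N => gam N / (N%:R * ln (N%:R / gam N))).
Proof.
(* The constant is [(2 g)^2 / (2 g * 1/2) = 4 g]: [kappa] is replaced by [2 g], and the logarithm
   loses one half to the terms [ln 2 + th * m]. *)
move=> gcvg; apply/eqO_exP; exists 4 => //; near=> N.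
have N2 : (2 <= N)%N by near: N; exact: nbhs_infty_ge.
have gh : gam N < 2^-1.
  by near: N; apply: (cvgr_lt _ gcvg); rewrite invr_gt0.
have LN : 2 * (ln 2 + th * m) <= ln (N%:R : R) by near: N; exact: near_ln_ge.
have LN1 : 1 <= ln (N%:R : R) by near: N; exact: near_ln_ge.
have N1 : 1 <= N%:R :> R by rewrite ler1n ltnW.
have NR0 : 0 < N%:R :> R by lra.
have /andP[g0 g1] := gamma_ratio_itv N2; have k0 := kappa_gt0 N2.
have k2g : kappa N <= 2 * gam N.
  have gg : 0 < 1 - gam N by rewrite subr_gt0.
  rewrite /kappa -lnV ?posrE//.
  (* Thus [kappa = ln (1 + g / (1 - g)) <= g / (1 - g)], which is at most [2 g] for [g < 1/2]. *)
  have -> : (1 - gam N)^-1 = 1 + gam N / (1 - gam N) by field; rewrite gt_eqF.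
  apply: le_trans (le_ln1Dx _) _.
    by rewrite (lt_trans (ltrN10 _))// divr_gt0.
  by rewrite ler_pdivrMr// mulrAC ler_peMl ?(ltW g0)//; lra.
have kN : kappa N <= N%:R by lra.
have Ng0 : 0 < N%:R / gam N by exact: divr_gt0.
have Nk0 : 0 < N%:R / kappa N by exact: divr_gt0.
have LgN : ln N%:R <= ln (N%:R / gam N).
  by rewrite ler_ln ?posrE// ler_pdivlMr// ler_piMr// ltW.
have La : ln (N%:R / gam N) / 2 <= ln (N%:R / kappa N) - th * m.
  have : ln (N%:R / gam N) - ln 2 <= ln (N%:R / kappa N).
    rewrite -ln_div ?posrE// ler_ln ?posrE//; last exact: divr_gt0.
    have g20 : 0 < gam N * 2 by exact: mulr_gt0.
    by rewrite -mulrA -invfM ler_pM2l// lef_pV2 ?posrE// [gam N * 2]mulrC.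
  lra.
have L0 : 0 < ln (N%:R / gam N) by lra.
have a0 : 0 < ln (N%:R / kappa N) - th * m by apply: lt_le_trans La; lra.
apply: le_trans (ratio_gap_quad N2 kN a0) _.
have NL0 : 0 < N%:R * ln (N%:R / gam N) by exact: mulr_gt0.
have gNL0 : 0 <= gam N / (N%:R * ln (N%:R / gam N)).
  by apply: divr_ge0; exact: ltW.
rewrite [leRHS](_ : _ = 4 * (gam N / (N%:R * ln (N%:R / gam N)))); last first.
  by rewrite (ger0_norm gNL0).
have Ng2 : 0 < 2 * N%:R * gam N by apply: mulr_gt0 => //; exact: mulr_gt0.
apply: (@le_trans _ _ ((2 * gam N) ^+ 2 / (2 * N%:R * gam N * (ln (N%:R / gam
  N) / 2)))).
  apply: ler_pM.
  - by apply: exprn_ge0; exact: ltW.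
  - by rewrite invr_ge0; apply: mulr_ge0; exact: ltW.
  - by rewrite lerXn2r// ?nnegrE; [exact: ltW|apply: mulr_ge0 => //;
      exact: ltW].
  - rewrite lef_pV2 ?posrE; first by rewrite ler_pM2l.
    + exact: mulr_gt0.
    + by apply: mulr_gt0 => //; exact: divr_gt0.
rewrite le_eqVlt; apply/orP; left; apply/eqP.
move: (gam N) (ln _) g0 L0 => g L g0 L0; field.
by rewrite ?gt_eqF.
Unshelve. all: by end_near. Qed.

Lemma ratio_efficiency : (fun N => gam N) @ \oo --> (1 : R) ->
  (forall N, (2 <= N)%N -> gam N < 1 - expR (- N%:R)) ->
  (fun N => 1 - ratio N) =O_\oo (fun N => (ln N%:R)^-1).
Proof.
(* Once [th * |m|] is at most a quarter of [ln N], the bound [2 / a] of [ratio_gap_lin] has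
   [a >= ln N / 4]. *)
move=> gcvg gN; apply/eqO_exP; exists 8 => //; near=> N.
have N2 : (2 <= N)%N by near: N; exact: nbhs_infty_ge.
have ge : 1 - expR (-1) <= gam N.
  apply/ltW; near: N; apply: (cvgr_gt _ gcvg).
  by rewrite gtrBl expR_gt0.
have LN : 4 * (th * `|m|) <= ln (N%:R : R) by near: N; exact: near_ln_ge.
have LN1 : 1 <= ln (N%:R : R) by near: N; exact: near_ln_ge.
have /andP[g0 g1] := gamma_ratio_itv N2.
have kN : kappa N <= N%:R.
  rewrite /kappa lerNl -ler_expR lnK ?posrE ?subr_gt0//.
  by have := gN N N2; lra.
have a0 : 0 < ln N%:R / 2 - th * `|m| by lra.
apply: le_trans (ratio_gap_lin N2 ge kN a0) _.
have L0 : 0 < ln (N%:R : R) by lra.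
have iL0 : 0 <= (ln (N%:R : R))^-1 by rewrite invr_ge0 ltW.
rewrite (ger0_norm iL0).
have -> : 8 / ln (N%:R : R) = 2 / (ln N%:R / 4) by field; rewrite gt_eqF.
by rewrite ler_pM2l// lef_pV2 ?posrE//; lra.
Unshelve. all: by end_near. Qed.

End relative_gap.

Theorem theorem4p4 (R : realType) (d : measure_display) (T : measurableType d)
  (P : probability T R) (sigma : R) (W : nat -> R -> {RV P >-> R})
  (G : {RV P >-> R}) (h b : nat -> R) (opt opt_hat : nat -> R * R)
  (sigma_gt0 : 0 < sigma)
  (W_brownian : forall i, brownian_motion sigma (W i))
  (W_indep : independent_processes P (fun i t => W i t : T -> R))
  (G_gumbel : standard_gumbel G)
  (h_gt0 : forall N, (2 <= N)%N -> 0 < h N)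
  (b_gt0 : forall N, (2 <= N)%N -> 0 < b N)
  (opt_min : forall N, (2 <= N)%N -> is_minimizer (F_cost P W h b N) (opt N))
  (opt_hat_min : forall N, (2 <= N)%N ->
    is_minimizer (F_approx P sigma W G h b N) (opt_hat N)) :
  let gamma := gamma_ratio h b in
  let ratio := cost_ratio (F_cost P W h b) opt opt_hat in
  [/\ forall g : R, 0 < g < 1 -> (forall N, (2 <= N)%N -> gamma N = g) ->
        (fun N => 1 - ratio N) =O_\oo (fun N => (N%:R * ln N%:R)^-1),
      gamma @ \oo --> (0 : R) ->
        (fun N => 1 - ratio N) =O_\oo
          (fun N => gamma N / (N%:R * ln (N%:R / gamma N)))
    & gamma @ \oo --> (1 : R) ->
      (forall N, (2 <= N)%N -> gamma N < 1 - expR (- N%:R)) ->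
        (fun N => 1 - ratio N) =O_\oo (fun N => (ln N%:R)^-1)].
Proof.
move=> gamma ratio; split.
- move=> g g01 gE.
  exact: (ratio_balanced sigma_gt0 W_brownian W_indep G_gumbel h_gt0 b_gt0
    opt_min opt_hat_min g01 gE).
- move=> g0.
  exact: (ratio_quality sigma_gt0 W_brownian W_indep G_gumbel h_gt0 b_gt0
    opt_min opt_hat_min g0).
- move=> g1 gN.
  exact: (ratio_efficiency sigma_gt0 W_brownian W_indep G_gumbel h_gt0 b_gt0
    opt_min opt_hat_min g1 gN).
Qed.
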